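(* Let $f\in\mathbb{C}[z]$ be a non-zero polynomial, $q_2=3\cdot2^{-5/3}f^2(dz)^2$, $q_3=f^3(dz)^3$, and let $\tilde E$ be the meromorphic extension to $(\mathbb{P}^1,\{\infty\})$ of $E=\mathbb{K}_{\mathbb{C},3}$ described in the context, with induced Higgs field $\tilde\theta$ and pairing $\tilde C$. Let $\mathcal{P}_*\tilde E$ be a filtered bundle over $\tilde E$ such that $(\mathcal{P}_*\tilde E,\tilde\theta)$ is good and the pairing $\tilde C$ is a perfect symmetric pairing of $(\mathcal{P}_*\tilde E,\tilde\theta)$. Let $d_2=\deg v_2$ and $d_3=\deg v_3$. Then there exists a neighborhood $U$ of $\infty$ such that $$\mathcal{P}_*\tilde E|_U=\mathcal{P}_*E_1|_U\oplus\mathcal{P}_*E_3|_U .$$ Moreover, for $c\in\mathbb{R}$, $$\mathcal{P}_cE_1|_U=\mathcal{O}_U([c-\deg f-2]\infty)\,s_1,\qquad \mathcal{P}_cE_3|_U=\mathcal{O}_U([c-d_2]\infty)\,v_2\oplus\mathcal{O}_U([c-d_3]\infty)\,v_3 .$$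
   Context: For $a\in\mathbb{R}$, $[a]$ is the integer with $a-1<[a]\le a$. Filtered bundles. Let $Y$ be a Riemann surface, $D\subset Y$ a finite set, $\mathcal{O}_Y( *D)$ the sheaf of meromorphic functions with poles contained in $D$. A filtered bundle $\mathcal{P}_*E$ over a locally free $\mathcal{O}_Y( *D)$-module $E$ of finite rank consists, for each $p\in D$, of free $\mathcal{O}_{Y,p}$-submodules $\mathcal{P}_cE_p\subset E_p$ ($c\in\mathbb{R}$), increasing in $c$, with $(\mathcal{P}_cE_p)( *p)=E_p$, $\mathcal{P}_cE_p=\bigcap_{a>c}\mathcal{P}_aE_p$ and $\mathcal{P}_{c+1}E_p=\mathcal{P}_cE_p\otimes\mathcal{O}_{Y,p}(p)$. For $c\in\mathbb{R}^D$, $\mathcal{P}_cE\subset E$ is the $\mathcal{O}_Y$-submodule with stalk $\mathcal{P}_{c^{(p)}}E_p$ at $p\in D$ and $E_p$ at $p\notin D$. A submodule $E'\subset E$ with $E/E'$ locally free gets the induced filtration $\mathcal{P}_cE'=\mathcal{P}_cE\cap E'$. For $s\in E_p$, $s\neq0$, $\deg s$ denotes the $c$ with $s\in\mathcal{P}_cE_p$ and $s\notin\bigcup_{a<c}\mathcal{P}_aE_p$. $\mathcal{P}^{(0)}_*(\mathcal{O}_Y( *D))$ is the filtered bundle with $\mathcal{P}^{(0)}_c=\mathcal{O}_Y(\sum_p[c^{(p)}]p)$. Tensor products are filtered by $\mathcal{P}_c(E_1\otimes E_2)_p=\sum_{a+b\le c}\mathcal{P}_aE_{1,p}\otimes\mathcal{P}_bE_{2,p}$;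 the dual $\mathcal{P}_*E^*$ is filtered by $\mathcal{P}_c(E^* )_p=\{g\mid g(\mathcal{P}_aE_p)\subset\mathcal{P}^{(0)}_{a+c}\ \forall a\}$. A filtered Higgs bundle is $(\mathcal{P}_*E,\theta)$ with $\theta:E\to E\otimes K_Y$. It is good if for each $p\in D$ there is a ramified covering $\varphi(\zeta)=\zeta^m$ of a neighborhood of $p$ such that the pull-back, with filtration $\mathcal{P}_c(\varphi^*E_p)=\sum_{ma+n\le c}\varphi^*(\mathcal{P}_aE_p)\otimes\mathcal{O}(np)$, decomposes as a direct sum of filtered Higgs bundles $(\mathcal{P}_*E_{\mathfrak a},\theta_{\mathfrak a})$, $\mathfrak a\in\zeta^{-1}\mathbb{C}[\zeta^{-1}]$, with $\theta_{\mathfrak a}-d\mathfrak a\,\mathrm{id}$ logarithmic with respect to the lattices $\mathcal{P}_bE_{\mathfrak a}$. A symmetric pairing $C$ of $(\mathcal{P}_*E,\theta)$ is a symmetric filtered morphism $\mathcal{P}_*E\otimes\mathcal{P}_*E\to\mathcal{P}^{(0)}_*(\mathcal{O}_Y( *D))$ with $C(\theta\otimes\mathrm{id})=C(\mathrm{id}\otimes\theta)$; it is perfect if the induced $\mathcal{P}_*E\to\mathcal{P}_*E^*$ is an isomorphism of filtered bundles. Setting. On $\mathbb{C}$ with coordinate $z$, $E=\mathbb{K}_{\mathbb{C},3}=K_{\mathbb{C}}\oplus\mathcal{O}\oplus K_{\mathbb{C}}^{-1}$ with Higgs field $\theta=\theta(q)=\begin{pmatrix}0&q_2&q_3\\1&0&q_2\\0&1&0\end{pmatrix}$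 and symmetric pairing $C$ with Gram matrix $\begin{pmatrix}0&0&1\\0&1&0\\1&0&0\end{pmatrix}$ in any frame $(d\zeta,1,(d\zeta)^{-1})$, $\zeta$ a local coordinate. Let $w=1/z$, $\omega=f\,dz=f_\infty\,dw$ near $\infty$. In the frame $(dw,1,(dw)^{-1})$ on a small punctured neighborhood of $\infty$ set $$s_1=\begin{pmatrix}5\cdot2^{-5/3}f_\infty^2\\2^{2/3}f_\infty\\1\end{pmatrix},\quad s_2=\begin{pmatrix}-2^{-5/3}f_\infty^2\\-2^{-1/3}f_\infty\\1\end{pmatrix},\quad s_3=\begin{pmatrix}-2^{2/3}f_\infty\\1\\0\end{pmatrix},$$ $$v_2=s_2,\qquad v_3=s_3-\frac{C(s_3,s_3)}{2\,C(s_2,s_3)}\,s_2,$$ so that $C(v_2,v_2)=C(v_3,v_3)=0$. $\tilde E$ is the locally free $\mathcal{O}_{\mathbb{P}^1}( *\infty)$-module extending $E$ generated near $\infty$ by $s_1,s_2,s_3$ over $\mathcal{O}( *\infty)$; $\theta$ and $C$ extend to $\tilde\theta:\tilde E\to\tilde E\otimes K_{\mathbb{P}^1}$ and $\tilde C:\tilde E\otimes\tilde E\to\mathcal{O}_{\mathbb{P}^1}( *\infty)$. With $\lambda_1=2^{2/3}\omega$, $\lambda_2=-2^{-1/3}\omega$, put $E_1=\mathrm{Ker}(\tilde\theta-\lambda_1\mathrm{id})$ and $E_3=\mathrm{Ker}(\tilde\theta-\lambda_2\mathrm{id})^2$, with induced filtrations. *)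

(* Defs.v *)
(* MathComp / MathComp-Analysis, with the complex numbers R[i] over an
   arbitrary R : realType. *)
From HB Require Import structures.
From mathcomp Require Import all_boot all_order all_algebra.
From mathcomp Require Import all_classical all_reals all_analysis.
From mathcomp Require Import complex ring.

Set Implicit Arguments.
Unset Strict Implicit.
Unset Printing Implicit Defensive.

Import Order.TTheory GRing.Theory Num.Theory.
Import numFieldNormedType.Exports.

Local Open Scope classical_set_scope.
Local Open Scope ring_scope.

(* R[i], packaged as a numClosedFieldType so that MathComp-Analysis finds the
   topology given by the modulus. *)
Definition cplx (R : realType) : numClosedFieldType := R[i].

(* Stalks at the origin of a disc. The germ of a section of a bundle with
   possible poles at 0 is a function on C, of which only the values at points
   w != 0 close to 0 matter: two functions represent the same germ when they
   agree near 0 on the punctured disc. A submodule of a stalk is a set of such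
   functions. Bundles are given through a frame over the punctured disc, so
   germs of sections are germs of column vectors. *)
Section Stalk.
Variable R : realType.
Local Notation C := (cplx R).

Definition germ_eq (T : Type) (g h : C -> T) : Prop :=
  \forall w \near (0 : C)^', g w = h w.

Local Notation "g =~ h" := (germ_eq g h) (at level 70, no associativity).

(* Holomorphic functions are taken to be the locally convergent power series. *)
Definition analytic_at (z : C) (g : C -> C) : Prop :=
  exists a : nat -> C,
    \forall x \near z, series (fun n => a n * (x - z) ^+ n) @ \oo --> g x.

(* Stalk at 0 of O(n.0): the germs g such that w^n g is holomorphic. *)
Definition germO (n : int) : set (C -> C) :=
  [set g | exists h, analytic_at 0 h /\ (fun w => w ^ n * g w) =~ h].

Definition holo : set (C -> C) := germO 0.

Definition mero : set (C -> C) := [set g | exists n : int, germO n g].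

Section Modules.
Variable r : nat.

Definition germs := C -> 'cV[C]_r.

Definition lincomb k (a : 'I_k -> C -> C) (e : 'I_k -> germs) : germs :=
  fun w => \sum_(i < k) a i w *: e i w.

(* The submodule generated by X over the ring of germs A (holo or mero). *)
Definition span (A : set (C -> C)) (X : set germs) : set germs :=
  [set s | exists k (a : 'I_k -> C -> C) (e : 'I_k -> germs),
    (forall i, A (a i) /\ X (e i)) /\ s =~ lincomb a e].

Definition free_module (A : set (C -> C)) (M : set germs) : Prop :=
  exists k (e : 'I_k -> germs),
    M = span A (range e) /\
    (forall a : 'I_k -> C -> C, (forall i, A (a i)) ->
       lincomb a e =~ (fun=> 0) -> forall i, a i =~ (fun=> 0)).

(* M tensored with O(n.0), that is, w^-n M *)
Definition twist (n : int) (M : set germs) : set germs :=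
  [set s | M (fun w => w ^ n *: s w)].

Definition germ_dsum k (M : set germs) (N : 'I_k -> set germs) : Prop :=
  (forall s, M s <->
     exists t : 'I_k -> germs,
       (forall i, N i (t i)) /\ s =~ (fun w => \sum_i t i w)) /\
  (forall t : 'I_k -> germs, (forall i, N i (t i)) ->
     (fun w => \sum_i t i w) =~ (fun=> 0) -> forall i, t i =~ (fun=> 0)).

Record filtered_bundle (E : set germs) (P : R -> set germs) : Prop := {
  fb_bundle : free_module mero E ;
  fb_lattice : forall c, free_module holo (P c) ;
  fb_mono : forall a b, a <= b -> P a `<=` P b ;
  fb_localize : forall c, \bigcup_(n in [set: int]) twist n (P c) = E ;
  fb_rcont : forall c, P c = \bigcap_(a in [set a | c < a]) P a ;
  fb_shift : forall c, P (c + 1) = twist 1 (P c) }.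

Definition deg (P : R -> set germs) (s : germs) : R :=
  xget 0 [set c | P c s /\ forall a, a < c -> ~ P a s].

(* A Higgs field theta is given by the matrix Theta with theta = Theta dw. *)
Definition apply_mx (Theta : C -> 'M[C]_r) (s : germs) : germs :=
  fun w => Theta w *m s w.

Definition filtered_higgs (E : set germs) (P : R -> set germs)
    (Theta : C -> 'M[C]_r) : Prop :=
  filtered_bundle E P /\ forall s, E s -> E (apply_mx Theta s).

(* The O-module pull-back by zeta |-> zeta^m, where O is given by the germs A *)
Definition pullback_mod (m : nat) (A : set (C -> C)) (M : set germs) :
    set germs :=
  span A [set (fun zeta => s (zeta ^+ m)) | s in M].

(* The sum over m a + n <= c of (pull-back of P_a) tensored with O(n.0) *)
Definition pullback_filt (m : nat) (P : R -> set germs) (c : R) : set germs :=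
  span holo [set t | exists (a : R) (n : int),
    m%:R * a + n%:~R <= c /\ twist n (pullback_mod m holo (P a)) t].

Definition pullback_higgs (m : nat) (Theta : C -> 'M[C]_r) : C -> 'M[C]_r :=
  fun zeta => (m%:R * zeta ^+ m.-1) *: Theta (zeta ^+ m).

(* An irregular value aa in zeta^-1 C[zeta^-1] is encoded by the polynomial p
   with p(0) = 0 and aa(zeta) = p(1/zeta); this is the function d aa/d zeta. *)
Definition dirr (p : {poly C}) (zeta : C) : C :=
  - zeta ^- 2 * (p^`()).[zeta^-1].

Definition good_filtered_higgs (E : set germs) (P : R -> set germs)
    (Theta : C -> 'M[C]_r) : Prop :=
  filtered_higgs E P Theta /\
  exists2 m : nat, (0 < m)%N &
  let Theta' := pullback_higgs m Theta in
  exists (k : nat) (aa : 'I_k -> {poly C})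
         (Ea : 'I_k -> set germs) (Pa : 'I_k -> R -> set germs),
    [/\ injective aa,
        forall i, (aa i).[0] = 0,
        forall i, filtered_higgs (Ea i) (Pa i) Theta',
        germ_dsum (pullback_mod m mero E) Ea /\
        (forall c, germ_dsum (pullback_filt m P c) (fun i => Pa i c)) &
        forall i b s, Pa i b s ->
          Pa i b (fun zeta =>
            zeta *: ((Theta' zeta - (dirr (aa i) zeta)%:M) *m s zeta))].

(* The pairing with Gram matrix G *)
Definition pairing (G : C -> 'M[C]_r) (s t : germs) : C -> C :=
  fun w => ((s w)^T *m G w *m t w) 0 0.

(* sp_filt says that the pairing maps P_c(E (x) E), the sum of the
   P_a (x) P_b over a + b <= c, to the c-th step O([c].0) of the filtered
   bundle P^(0) over O( *0). *)
Record symmetric_pairing (E : set germs) (P : R -> set germs)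
    (Theta G : C -> 'M[C]_r) : Prop := {
  sp_mero : forall s t, E s -> E t -> mero (pairing G s t) ;
  sp_sym : forall s t, E s -> E t -> pairing G s t =~ pairing G t s ;
  sp_filt : forall a b c s t, a + b <= c -> P a s -> P b t ->
    germO (Num.floor c) (pairing G s t) ;
  sp_higgs : forall s t, E s -> E t ->
    pairing G (apply_mx Theta s) t =~ pairing G s (apply_mx Theta t) }.

(* The elements of the dual stalk are the functions on germs that induce
   mero-linear maps from E to mero. *)
Definition in_dual (E : set germs) (g : germs -> C -> C) : Prop :=
  [/\ forall s, E s -> mero (g s),
      forall s t, E s -> E t -> s =~ t -> g s =~ g t &
      forall h s t, mero h -> E s -> E t ->
        g (fun w => h w *: s w + t w) =~ (fun w => h w * g s w + g t w)].

Definition dual_filt (E : set germs) (P : R -> set germs) (c : R)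
    (g : germs -> C -> C) : Prop :=
  in_dual E g /\
  forall a s, P a s -> germO (Num.floor (a + c)) (g s).

(* s |-> G(s, -) is injective and surjective from E to its dual, and
   identifies the two filtrations. *)
Record perfect_pairing (E : set germs) (P : R -> set germs)
    (G : C -> 'M[C]_r) : Prop := {
  pp_inj : forall s, E s ->
    (forall t, E t -> pairing G s t =~ (fun=> 0)) -> s =~ (fun=> 0) ;
  pp_surj : forall g, in_dual E g ->
    exists s, E s /\ forall t, E t -> g t =~ pairing G s t ;
  pp_filt : forall c s, E s -> (P c s <-> dual_filt E P c (pairing G s)) }.

End Modules.
End Stalk.

(* The Riemann sphere, glued from the charts z and w = 1/z (None is the point
   at infinity), and its sheaves. A sheaf is described by its sections
   over the open sets; sections are represented by functions of z, of which
   only the values at the finite points of the open set matter (they determine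
   the section). *)
Section Sphere.
Variable R : realType.
Local Notation C := (cplx R).

Definition P1 := option C.

Definition chart0 (z : C) : P1 := Some z.

Definition chartoo (w : C) : P1 := if w == 0 then None else Some w^-1.

Definition P1_open (V : set P1) : Prop :=
  open (chart0 @^-1` V) /\ open (chartoo @^-1` V).

(* Sections over V of O(n.oo) *)
Definition sheafO (n : int) (V : set P1) : set (C -> C) :=
  [set g | (forall z, V (Some z) -> analytic_at z g) /\
           (V None -> germO n (fun w => g w^-1))].

(* With w = 1/z, multiplication by frame_mx w turns coordinates in the frame
   (dz, 1, (dz)^-1) into coordinates in the frame (dw, 1, (dw)^-1), because
   dz = - w^-2 dw. As dw = - z^-2 dz, frame_mx z gives the converse change, and
   change_chart transforms sections in both directions. *)
Definition frame_mx (w : C) : 'M[C]_3 :=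
  diag_mx (\row_(i < 3) [:: - w ^- 2; 1; - w ^+ 2]`_i).

Definition change_chart (s : germs R 3) : germs R 3 :=
  fun w => frame_mx w *m s w^-1.

Definition col3 (a b c : C) : 'cV[C]_3 := \col_(i < 3) [:: a; b; c]`_i.

Definition mx3 (l : seq (seq C)) : 'M[C]_3 := 
  \matrix_(i < 3, j < 3) (nth [::] l i)`_j.

Definition gram : 'M[C]_3 :=
  mx3 [:: [:: 0; 0; 1];
          [:: 0; 1; 0];
          [:: 1; 0; 0]].

Definition theta_mx (q2 q3 : C) : 'M[C]_3 :=
  mx3 [:: [:: 0; q2; q3];
          [:: 1; 0 ; q2];
          [:: 0; 1 ; 0 ]].

(* the complex number 2^a, for a real exponent a *)
Definition pow2 (a : R) : C := (2 `^ a)%:C%C.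

Definition q2 (h : C) : C := 3 * pow2 (- (5 / 3)) * h ^+ 2.
Definition q3 (h : C) : C := h ^+ 3.

(* theta(q), in a chart where omega = h d(coordinate) *)
Definition theta (h : C) : 'M[C]_3 := theta_mx (q2 h) (q3 h).

(* Sections over V of the extension of K + O + K^-1 to P^1 whose stalk at oo,
   in coordinates with respect to (dw, 1, (dw)^-1), is M; the functions are the
   coordinates in (dz, 1, (dz)^-1). *)
Definition extension (M : set (germs R 3)) (V : set P1) : set (germs R 3) :=
  [set s : germs R 3 |
    (forall z, V (Some z) -> forall i, analytic_at z (fun x => s x i 0)) /\
    (V None -> M (change_chart s))].

Definition sheaf := set P1 -> set (germs R 3).

(* The kernel of the endomorphism A of F. By continuity, it does not matter
   that the equation is only imposed at the finite points. *)
Definition ker_sheaf (A : C -> 'M[C]_3) (F : sheaf) : sheaf :=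
  fun V => [set s | F V s /\ forall z, V (Some z) -> A z *m s z = 0].

Definition capsheaf (F G : sheaf) : sheaf := fun V => F V `&` G V.

Definition eq_on (V : set P1) (s t : germs R 3) : Prop :=
  forall z, V (Some z) -> s z = t z.

(* O(n.oo) s *)
Definition line (n : int) (s : germs R 3) : sheaf :=
  fun V => [set t | exists g, sheafO n V g /\ eq_on V t (fun z => g z *: s z)].

Definition eq_sheaf (U : set P1) (F G : sheaf) : Prop :=
  forall V, P1_open V -> V `<=` U -> F V = G V.

(* F|_U is the direct sum of its subsheaves A|_U and B|_U *)
Definition dsum_sheaf (U : set P1) (F A B : sheaf) : Prop :=
  forall V, P1_open V -> V `<=` U ->
    (forall s, F V s <-> exists a b, [/\ A V a, B V b &
                           eq_on V s (fun z => a z + b z)]) /\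
    (forall s, A V s -> B V s -> eq_on V s (fun=> 0)).

Section Bundle.
Variable f : {poly C}.

(* omega = f dz = foo dw *)
Definition foo (w : C) : C := - w ^- 2 * f.[w^-1].

Definition s1 : germs R 3 := fun w =>
  col3 (5 * pow2 (- (5 / 3)) * foo w ^+ 2) (pow2 (2 / 3) * foo w) 1.
Definition s2 : germs R 3 := fun w =>
  col3 (- pow2 (- (5 / 3)) * foo w ^+ 2) (- pow2 (- (1 / 3)) * foo w) 1.
Definition s3 : germs R 3 := fun w =>
  col3 (- pow2 (2 / 3) * foo w) 1 0.

Definition gramC : C -> 'M[C]_3 := fun=> gram.

Definition v2 : germs R 3 := s2.
Definition v3 : germs R 3 := fun w =>
  s3 w - (pairing gramC s3 s3 w / (2 * pairing gramC s2 s3 w)) *: s2 w.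

(* the stalk of the extended bundle at oo *)
Definition Etilde_oo : set (germs R 3) := span (@mero R) [set s1; s2; s3]%classic.

Definition theta_oo : C -> 'M[C]_3 := fun w => theta (foo w).

Definition Etilde : sheaf := extension Etilde_oo.

Definition E1 : sheaf :=
  ker_sheaf (fun z => theta f.[z] - (pow2 (2 / 3) * f.[z])%:M) Etilde.

Definition E3 : sheaf :=
  ker_sheaf (fun z => let N := theta f.[z] - (- pow2 (- (1 / 3)) * f.[z])%:M in
                      N *m N) Etilde.

(* A filtered bundle over the extension is a filtration P of its stalk at oo;
   these are the sheaves P_c and the induced filtrations of E1 and E3. *)
Definition PEtilde (P : R -> set (germs R 3)) (c : R) : sheaf := extension (P c).

Definition PE1 (P : R -> set (germs R 3)) (c : R) : sheaf :=
  capsheaf (PEtilde P c) E1.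

Definition PE3 (P : R -> set (germs R 3)) (c : R) : sheaf :=
  capsheaf (PEtilde P c) E3.

End Bundle.

(* theta and the pairing are given by the same formulas in the charts z and w,
   so theta_oo and gramC do describe their extensions to oo. *)

Lemma frame_mxV (w : C) : w != 0 -> frame_mx w *m frame_mx w^-1 = 1%:M.
Proof.
move=> w0; rewrite mulmx_diag; apply/matrixP => i j; rewrite !mxE.
case: eqP => [->|_]; last by [].
case: j => [[|[|[|]]]] //= _; rewrite ?mulr1n; by field.
Qed.

Lemma change_chartK (s : germs R 3) (w : C) :
  w != 0 -> change_chart (change_chart s) w = s w.
Proof. by move=> w0; rewrite /change_chart mulmxA frame_mxV// mul1mx invrK. Qed.

Lemma frame_mx_theta (f : {poly C}) (w : C) : w != 0 ->
  theta (foo f w) *m frame_mx w = - w ^- 2 *: (frame_mx w *m theta f.[w^-1]).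
Proof.
move=> w0; rewrite /theta /foo /q2 /q3 mul_mx_diag mul_diag_mx.
set h := f.[_]; set c := pow2 _.
apply/matrixP => i j; rewrite !mxE.
by case: i => [[|[|[|]]]] //= _; case: j => [[|[|[|]]]] //= _; field.
Qed.

Lemma theta_change_chart (f : {poly C}) (s : germs R 3) (w : C) : w != 0 ->
  apply_mx (theta_oo f) (change_chart s) w =
  - w ^- 2 *: change_chart (fun z => theta f.[z] *m s z) w.
Proof.
move=> w0; rewrite /apply_mx /theta_oo /change_chart mulmxA frame_mx_theta//.
by rewrite -scalemxAl mulmxA.
Qed.

Lemma pairing_change_chart (s t : germs R 3) (w : C) : w != 0 ->
  pairing gramC (change_chart s) (change_chart t) w = pairing gramC s t w^-1.
Proof.
move=> w0; rewrite /pairing /gramC /change_chart trmx_mul tr_diag_mx.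
suff e : frame_mx w *m gram *m frame_mx w = gram.
  by rewrite -[in RHS]e !mulmxA.
rewrite mul_mx_diag mul_diag_mx.
apply/matrixP => i j; rewrite !mxE.
by case: i => [[|[|[|]]]] //= _; case: j => [[|[|[|]]]] //= _; field.
Qed.

End Sphere.

(* Main.v *)
Require Import Defs.
From HB Require Import structures.
From mathcomp Require Import all_boot all_order all_algebra.
From mathcomp Require Import all_classical all_reals all_analysis.
From mathcomp Require Import complex ring lra zify.

Set Implicit Arguments.
Unset Strict Implicit.
Unset Printing Implicit Defensive.

Import Order.TTheory GRing.Theory Num.Theory.
Import numFieldNormedType.Exports.

Local Open Scope classical_set_scope.
Local Open Scope ring_scope.

(** Put h = f_oo and t = h / 2^(1/3), so that near infinity theta has the simple
    eigenvalue 2t, with eigenvector s1, and the double eigenvalue -t, with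
    eigenvector v2 and v3 in its generalized eigenspace. In the frame s1, v2, v3
    the only nonzero values of the pairing are C(s1, s1) = 9 t^2 and
    C(v2, v3) = - 3 t. The theorem says that the filtration is diagonal in this
    frame: a germ lies in P_c if and only if its three components do, and a
    component g s1 lies in P_c if and only if g has a pole of order at most
    c - deg f - 2, with d2 and d3 in place of deg f + 2 for v2 and v3
    ([lattice_coordsP]). Let N = deg f + 2 be the order of the pole of t.

    The E1-component ([gcoord1_lattice]). The projection onto E1 is
    (theta + t)^2 / (3 t)^2. By goodness, after pull-back by w = zeta^m each P_c
    becomes a direct sum of lattices L on which theta - d aa has at most a
    logarithmic pole. If the pole of d aa is at most that M >= 2 of the
    pulled-back t, then zeta^M (theta + t) maps L to L, and so does the projection
    ([projector_lattice]). Otherwise the leading term of d aa dominates theta, the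
    identity (theta - 2t) (theta + t)^2 = 0 forces L = zeta L, and L = 0
    ([lattice_irregular_zero]). Either way the projection preserves the pulled-back
    lattice. To come back to P_c, note that by perfectness membership in P_c is
    read off the orders of the poles of pairings with other germs, and pull-back
    multiplies these orders by m ([pullback_filt_descent]).

    The degree of s1 ([lattice_s1]). C(s1, s1) has a pole of order 2N, so s1 in P_c
    implies 2N <= 2c. Conversely, if x = g s1 + ... is in P_a then g s1 is in P_a,
    hence g has a pole of order at most a - N and C(s1, x) one of order at most
    a + N; by perfectness s1 is in P_N.

    The v2- and v3-components ([gcoord2_lattice]). Suppose that
    y = y2 + y3 is in P_c, with y2 and y3 multiples of v2 and v3, and that y2 is
    not. By perfectness there is x = x2 + x3 in some P_a (the E1-component of x may
    be dropped) such that C(y2, x) = C(y2, x3) has a pole of order > a + c, and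
    since C(y, x) has not, C(y3, x) = C(y3, x2) also has one. As v2 and v3 are isotropic,
    C(y, y) = 2 C(y2, y3) and C(x, x) = 2 C(x2, x3) have poles of orders at most 2c
    and 2a; but C(y2, x3) C(y3, x2) = C(y2, y3) C(x2, x3), and the orders of the
    poles of the two sides are > 2a + 2c and <= 2a + 2c.

    Over the sphere, U consists of infinity and of the z with z <> 0 and f(z) <> 0,
    where the frame s1, v2, v3 is defined; a section over an open subset of U is
    then the same as three functions, and each of the sheaves of the theorem is
    described by conditions on these ([extension_coords]).

    The meromorphic germs are handled through convergent power series, for which
    products, inverses and the order of vanishing are obtained from estimates on
    partial sums. *)

Local Notation "g =~ h" := (germ_eq g h) (at level 70, no associativity).
Local Notation span := Defs.span.

(** * Convergent power series *)

Section PowerSeries.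
Variable R : realType.
Local Notation C := (cplx R).
Implicit Types (a b : nat -> C) (g h : C -> C) (x y z l M r e : C).

Definition psum a y : nat -> C := series (fun n => a n * y ^+ n).

Lemma psumE a y N : psum a y N = \sum_(n < N) a n * y ^+ n.
Proof. by rewrite /psum /series /= big_mkord. Qed.

Lemma cplx_archi x : 0 <= x -> exists N : nat, x < N%:R.
Proof.
move=> x0; have xE : x = (complex.Re x)%:C%C.
  by apply/eqP; rewrite eq_complex /=; have := ger0_Im x0; case: (x) => ? ? /= ->; rewrite !eqxx.
have [N hN] : exists N : nat, complex.Re x < N%:R.
  by exists (Num.truncn (complex.Re x)).+1; exact: truncnS_gt.
exists N; rewrite xE -[N%:R](rmorph_nat (real_complex R)) ltcR //.
Qed.

Lemma pow2_cvg0 M e : 0 <= M -> 0 < e -> \forall n \near \oo, M * 2 ^- n < e.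
Proof.
move=> M0 e0; have [N hN] := cplx_archi (divr_ge0 M0 (ltW e0)).
exists N => // n /= Nn; rewrite ltr_pdivrMr ?exprn_gt0 ?ltr0n//.
rewrite mulrC -ltr_pdivrMr//; apply: (lt_le_trans hN).
by rewrite -natrX ler_nat (leq_trans Nn)// ltnW// ltn_expl.
Qed.

(** The order of C is partial; explicit geometric bounds replace the squeeze
    theorem for real sequences. *)
Lemma cvg_pow2_bound (u : nat -> C) l M : 0 <= M ->
  (forall n, `|l - u n| <= M * 2 ^- n) -> u @ \oo --> l.
Proof.
move=> M0 hu; apply/cvgrPdist_lt => e e0.
by apply: filterS (pow2_cvg0 M0 e0) => n; apply: le_lt_trans.
Qed.

(** The terms of a convergent series are bounded: the Cauchy estimate on which all
    further bounds rest. *)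
Lemma coef_bound a y l : y != 0 -> psum a y @ \oo --> l ->
  exists2 M, 0 < M & forall n, `|a n| <= M * `|y| ^- n.
Proof.
move=> y0 cvl.
have cv0 : (fun n => a n * y ^+ n) @ \oo --> (0 : C).
  by apply: (@cvg_series_cvg_0 _ C^o); exact: (cvgP _ cvl).
have bd := @cvg_seq_bounded _ C^o _ (cvgP _ cv0).
have [M M0 hM] := pinfty_ex_gt0 bd.
exists M => // n; rewrite ler_pdivlMr ?exprn_gt0 ?normr_gt0//.
by rewrite -normrX -normrM; exact: (hM n I).
Qed.

(** Convergence together with a Cauchy estimate on the same disc. *)
Definition expansion z g a M r := [/\ 0 < M, 0 < r,
  forall n, `|a n| <= M * r ^- n &
  forall y, `|y| < r -> psum a y @ \oo --> g (z + y)].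

Lemma analytic_expansion z g : analytic_at z g -> exists a M r, expansion z g a M r.
Proof.
case=> a /nbhs_normP[e /= e0 he]; exists a.
have y0 : e / 2 != 0 by rewrite mulf_neq0 ?invr_eq0 ?pnatr_eq0// gt_eqF.
have cv y : `|y| < e -> psum a y @ \oo --> g (z + y).
  move=> ye; have := he (z + y); rewrite /ball_ /= opprD addNKr normrN => /(_ ye).
  by under eq_fun do rewrite (addrC z) addrK; rewrite addrC.
have ne2 : `|e / 2| = e / 2 by rewrite ger0_norm// divr_ge0// ltW.
have lt2 : e / 2 < e by rewrite ltr_pdivrMr// mulr_natr mulr2n ltrDl.
have [|M M0 hM] := coef_bound y0 (cv (e / 2) _); first by rewrite ne2.
exists M, (e / 2); split=> //; first by rewrite divr_gt0.
  by move=> n; rewrite -{1}ne2.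
by move=> y ye; apply: cv; apply: lt_trans lt2.
Qed.

Lemma expansion_analytic z g a r : 0 < r ->
  (forall y, `|y| < r -> psum a y @ \oo --> g (z + y)) -> analytic_at z g.
Proof.
move=> r0 h; exists a; apply/nbhs_normP; exists r => // x /=.
rewrite distrC => xr; by have := h _ xr; rewrite [z + _]addrC subrK.
Qed.

Lemma expansion_shrink z g a M r r' : 0 < r' -> r' <= r ->
  expansion z g a M r -> expansion z g a M r'.
Proof.
move=> r'0 rr [M0 r0 ha cv]; split=> //; last first.
  by move=> y yr; apply: cv; apply: lt_le_trans rr.
move=> n; apply: le_trans (ha n) _; rewrite ler_pM2l// lef_pV2 ?posrE ?exprn_gt0//.
by rewrite lerXn2r// nnegrE ltW.
Qed.

Lemma coef_norm a M r n y : 0 < M -> 0 < r -> (forall n, `|a n| <= M * r ^- n) ->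
  `|y| <= r / 8 -> `|a n * y ^+ n| <= M * 8 ^- n.
Proof.
move=> M0 r0 ha yr; rewrite normrM normrX.
have h : `|y| ^+ n <= (r / 8) ^+ n by rewrite lerXn2r ?nnegrE ?divr_ge0// ltW.
apply: le_trans (ler_pM _ _ (ha n) h) _ => //.
by rewrite exprMn exprVn mulrA mulfVK// expf_neq0// gt_eqF.
Qed.

Lemma natr2_ge (n : nat) : n%:R <= 2 ^+ n :> C.
Proof. by rewrite -natrX ler_nat ltnW// ltn_expl. Qed.

Definition cauchy_product a b n := \sum_(i < n.+1) a i * b (n - i)%N.

Lemma psum_cauchy_product a b y N :
  psum (cauchy_product a b) y N =
  \sum_(i < N) \sum_(j < N | (i + j < N)%N) (a i * y ^+ i) * (b j * y ^+ j).
Proof.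
rewrite psumE.
pose F i j := (a i * y ^+ i) * (b j * y ^+ j).
have -> : \sum_(n < N) cauchy_product a b n * y ^+ n =
   \sum_(n < N) \sum_(i < N | (i < n.+1)%N) F i (n - i)%N.
  apply: eq_bigr => n _; rewrite /cauchy_product mulr_suml.
  rewrite (big_ord_widen N (fun i => a i * b (n - i)%N * y ^+ n)) ?ltn_ord//.
  apply: eq_bigr => i hi; rewrite /F mulrACA -exprD subnKC//.
rewrite (exchange_big_dep xpredT)//=; apply: eq_bigr => i _.
rewrite -(big_mkord (fun n => (i < n.+1)%N) (fun n => F i (n - i)%N)).
rewrite -(big_mkord (fun j => (i + j < N)%N) (F i)).
have iN := ltn_ord i.
rewrite (@big_cat_nat _ _ _ i) ?leq0n 1?ltnW//= big_nat_cond big1 ?add0r; last first.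
  by move=> n /andP[/andP[_ h1] h2]; lia.
rewrite -{1}(add0n (nat_of_ord i)) big_addn [RHS](@big_cat_nat _ _ _ (N - i)) ?leq0n ?leq_subr//=.
rewrite [X in _ = _ + X]big_nat_cond [X in _ = _ + X]big1 ?addr0; last first.
  by move=> n /andP[/andP[h1 _] h2]; lia.
rewrite big_nat_cond [RHS]big_nat_cond; apply: eq_big => [n|n _]; last by rewrite addnK.
by apply/idP/idP; lia.
Qed.

(** The difference consists of the terms with i + j >= N, whose sum is
    exponentially small close to the centre. So products and inverses of power
    series need neither absolute convergence nor completeness. *)
Lemma psum_cauchy_product_near a b M M' r y N : 0 < r -> 0 < M -> 0 < M' ->
  (forall n, `|a n| <= M * r ^- n) -> (forall n, `|b n| <= M' * r ^- n) ->
  `|y| <= r / 8 ->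
  `|psum a y N * psum b y N - psum (cauchy_product a b) y N| <= M * M' * 2 ^- N.
Proof.
move=> r0 M0 M'0 ha hb yr; rewrite psum_cauchy_product !psumE mulr_suml -sumrB.
have -> : \sum_(i < N) (a i * y ^+ i * (\sum_(j < N) b j * y ^+ j) -
     \sum_(j < N | (i + j < N)%N) a i * y ^+ i * (b j * y ^+ j)) =
   \sum_(i < N) \sum_(j < N | (N <= i + j)%N) a i * y ^+ i * (b j * y ^+ j).
  apply: eq_bigr => i _; rewrite mulr_sumr (bigID (fun j : 'I_N => (i + j < N)%N))/=.
  by rewrite [X in X - _]addrC addrK; apply: eq_bigl => j; rewrite -leqNgt.
have step (i j : 'I_N) : (N <= i + j)%N ->
    `|a i * y ^+ i * (b j * y ^+ j)| <= M * M' * 8 ^- N.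
  move=> hij; rewrite normrM; apply: le_trans (ler_pM _ _ (coef_norm _ M0 r0 ha yr) (coef_norm _
      M'0 r0 hb yr)) _ => //.
  rewrite mulrACA ler_pM2l ?mulr_gt0// -!exprVn -exprD.
  by rewrite ler_wiXn2l// ?invr_ge0// invf_le1// ler1n.
apply: le_trans (ler_norm_sum _ _ _) _.
apply: (@le_trans _ _ (\sum_(i < N) \sum_(j < N) M * M' * 8 ^- N)).
  apply: ler_sum => i _; apply: le_trans (ler_norm_sum _ _ _) _.
  rewrite big_mkcond; apply: ler_sum => j _; case: ifP => [/step//|_].
  by rewrite !mulr_ge0// ?invr_ge0 ?exprn_ge0// ltW.
(* There are at most N^2 <= 4^N pairs, and 4^N 8^-N = 2^-N. *)
rewrite !sumr_const !card_ord -[leLHS]mulr_natr -[X in X * _ <= _]mulr_natr.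
have hN : N%:R * N%:R <= 2 ^+ N * 2 ^+ N :> C by rewrite ler_pM// natr2_ge.
have -> : M * M' * 8 ^- N * N%:R * N%:R =
    M * M' * 2 ^- N * ((N%:R * N%:R) / (2 ^+ N * 2 ^+ N)).
  have -> : 8 = 2 * 2 * 2 :> C by ring.
  by rewrite !exprMn; field; rewrite expf_neq0.
rewrite ler_piMr ?mulr_ge0 ?invr_ge0 ?exprn_ge0 ?(ltW M0) ?(ltW M'0)//.
by rewrite ler_pdivrMr ?mulr_gt0 ?exprn_gt0// mul1r.
Qed.

Lemma expansion_head z g a M r : expansion z g a M r -> g z = a 0%N.
Proof.
move=> [_ r0 _ /(_ 0)]; rewrite normr0 addr0 => /(_ r0) cv.
apply: (cvg_unique (@norm_hausdorff _ C^o) cv); apply: cvg_near_cst.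
exists 1%N => // n /= n0; rewrite psumE; case: n n0 => // n _.
rewrite big_ord_recl expr0 mulr1 big1 ?addr0// => i _.
by rewrite lift0 expr0n mulr0.
Qed.

Lemma geometric8_le N : \sum_(i < N) 8 ^- i <= 2 :> C.
Proof.
(* Strengthened for the induction: 8^-N <= 2 8^-N - 2 8^-(N+1). *)
suff : \sum_(i < N) 8 ^- i <= 2 - 2 * 8 ^- N :> C.
  by move/le_trans; apply; rewrite gerBl mulr_ge0// invr_ge0 exprn_ge0.
elim: N => [|N IH]; first by rewrite big_ord0 expr0 invr1 mulr1 subrr.
rewrite big_ord_recr/=; apply: le_trans (lerD IH (lexx _)) _.
rewrite -subr_ge0 exprS.
have -> : 2 - 2 / (8 * 8 ^+ N) - (2 - 2 * 8 ^- N + 8 ^- N) = 3 / 4 * 8 ^- N :> C.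
  by field; rewrite expf_neq0.
by rewrite mulr_ge0// invr_ge0 exprn_ge0.
Qed.

Lemma psum_head_near a M r y N : 0 < r -> 0 < M ->
  (forall n, `|a n| <= M * r ^- n) -> `|y| <= r / 8 ->
  `|psum a y N.+1 - a 0%N| <= M * 8 / r * `|y|.
Proof.
move=> r0 M0 ha yr; rewrite psumE big_ord_recl expr0 mulr1 addrC addKr.
apply: le_trans (ler_norm_sum _ _ _) _.
have step (i : 'I_N) : true -> `|a (lift ord0 i) * y ^+ lift ord0 i| <=
    (M / r * `|y|) * 8 ^- i.
  move=> _; rewrite lift0 normrM normrX exprS mulrCA mulrC.
  rewrite [leRHS](_ : _ = (M / r * 8 ^- i) * `|y|); last by ring.
  rewrite ler_wpM2r//.
  have h : `|y| ^+ i <= (r / 8) ^+ i by rewrite lerXn2r ?nnegrE ?divr_ge0// ltW.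
  apply: le_trans (ler_pM _ _ (ha i.+1) h) _ => //.
  have r8 : r != 0 by rewrite gt_eqF.
  have e8 : (8 : C) ^+ i != 0 by rewrite expf_neq0.
  rewrite exprMn exprVn exprS le_eqVlt; apply/orP; left; apply/eqP; field.
  by rewrite e8 r8 expf_neq0.
apply: le_trans (ler_sum _ step) _; rewrite -mulr_sumr.
rewrite [leRHS](_ : _ = (M / r * `|y|) * 8); last by ring.
rewrite ler_wpM2l// ?mulr_ge0 ?invr_ge0// ?(ltW M0) ?(ltW r0)//.
by apply: le_trans (geometric8_le N) _; rewrite ler_nat.
Qed.

Lemma expansion_head_near z g a M r y : expansion z g a M r -> `|y| < r / 8 ->
  `|g (z + y) - g z| <= M * 8 / r * `|y|.
Proof.
move=> ex yr; rewrite (expansion_head ex); case: ex => M0 r0 ha cv.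
have yr' : `|y| < r.
  by apply: lt_le_trans yr _; rewrite ler_pdivrMr// ler_peMr ?(ltW r0)// ler1n.
apply/ler_addgt0Pl => e e0.
have /cvgrPdist_le/(_ _ e0)[N _ hN] := cv y yr'.
have := hN N.+1 (leqnSn _) => /= h.
rewrite -(subrK (psum a y N.+1) (g _)) -addrA.
apply: le_trans (ler_normD _ _) _; rewrite lerD//.
exact: psum_head_near (ltW yr).
Qed.

Lemma analytic_bounded z g : analytic_at z g ->
  exists2 K, 0 < K & \forall x \near z, `|g x| <= K.
Proof.
move=> /analytic_expansion[a [M [r ex]]]; have [M0 r0 _ _] := ex.
exists (M + `|g z|); first by rewrite ltr_wpDr.
apply/nbhs_normP; exists (r / 8); first by rewrite /= divr_gt0.
move=> x /=; rewrite distrC => xr.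
have := expansion_head_near ex xr; rewrite [z + _]addrC subrK => h.
rewrite -lerBlDr; apply: le_trans (lerB_dist _ _) _; apply: le_trans h _.
rewrite -!mulrA ler_piMr ?(ltW M0)//.
by rewrite mulrCA ler_pdivrMl// mulr1 mulrC -ler_pdivlMr// ltW.
Qed.

Lemma analytic_near_neq0 z g : analytic_at z g -> g z != 0 ->
  \forall x \near z, g x != 0.
Proof.
move=> /analytic_expansion[a [M [r ex]]] g0; have [M0 r0 _ _] := ex.
have K0 : 0 < M * 8 / r by rewrite divr_gt0// mulr_gt0.
have n0 : 0 < `|g z| by rewrite normr_gt0.
have h1 : \forall x \near z, `|z - x| < r / 8.
  by apply/nbhs_normP; exists (r / 8); rewrite /= ?divr_gt0.
have h2 : \forall x \near z, `|z - x| < `|g z| / (M * 8 / r).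
  by apply/nbhs_normP; exists (`|g z| / (M * 8 / r)); rewrite /= ?(divr_gt0 n0).
apply: filterS2 h1 h2 => x; rewrite distrC => h1; rewrite ltr_pdivlMr// => h2.
apply/eqP => gx; have := expansion_head_near ex h1.
rewrite [z + _]addrC subrK gx sub0r normrN mulrC => /le_lt_trans/(_ h2).
by rewrite ltxx.
Qed.

Lemma seqD_cvg (u v : nat -> C) l l' : u @ \oo --> l -> v @ \oo --> l' ->
  (fun n => u n + v n) @ \oo --> l + l'.
Proof. exact: (@cvgD C C^o). Qed.

Lemma seqM_cvg (u v : nat -> C) l l' : u @ \oo --> l -> v @ \oo --> l' ->
  (fun n => u n * v n) @ \oo --> l * l'.
Proof. exact: (@cvgM C). Qed.

Lemma seqV_cvg (u : nat -> C) l : l != 0 -> u @ \oo --> l ->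
  (fun n => (u n)^-1) @ \oo --> l^-1.
Proof. exact: (@cvgV C). Qed.

Lemma analytic_cst z c : analytic_at z (fun=> c).
Proof.
apply: (@expansion_analytic _ _ (fun n => if n is 0%N then c else 0) 1) => // y _.
apply: cvg_near_cst; exists 1%N => // n /= n0; rewrite psumE; case: n n0 => // n _.
by rewrite big_ord_recl expr0 mulr1 big1 ?addr0// => i _; rewrite mul0r.
Qed.

Lemma analytic_id z : analytic_at z id.
Proof.
apply: (@expansion_analytic _ _ (fun n => if n is 0%N then z else (n == 1%N)%:R) 1) => // y _.
apply: cvg_near_cst; exists 2%N => // n /= n0; rewrite psumE.
case: n n0 => // -[//|n] _.
rewrite !big_ord_recl expr0 expr1 mulr1 mul1r big1 ?addr0// => i _; by rewrite mul0r.
Qed.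

(** The order of C is partial, so r r' / (r + r') serves as a common lower bound
    instead of the minimum. *)
Lemma common_radius r r' : 0 < r -> 0 < r' -> exists s : C, [/\ 0 < s, s <= r & s <= r'].
Proof.
move=> r0 r'0; exists (r * r' / (r + r')).
have p : 0 < r + r' by rewrite addr_gt0.
rewrite divr_gt0 ?mulr_gt0// !ler_pdivrMr//; split=> //.
  by rewrite ler_pM2l// lerDr ltW.
by rewrite mulrC ler_pM2l// lerDl ltW.
Qed.

Lemma analytic_add z g h : analytic_at z g -> analytic_at z h ->
  analytic_at z (fun x => g x + h x).
Proof.
move=> [a ha] [b hb]; exists (fun n => a n + b n).
apply: filterS2 ha hb => x ha hb.
rewrite (_ : series _ = (fun n => psum a (x - z) n + psum b (x - z) n)).
  exact: (seqD_cvg ha hb).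
apply/funext => n; rewrite [LHS](psumE (fun n => a n + b n)) !psumE -big_split/=.
by apply: eq_bigr => i _; rewrite mulrDl.
Qed.

Lemma analytic_mul z g h : analytic_at z g -> analytic_at z h ->
  analytic_at z (fun x => g x * h x).
Proof.
move=> /analytic_expansion[a [M [r exa]]] /analytic_expansion[b [M' [r' exb]]].
have [_ r0 _ _] := exa; have [_ r'0 _ _] := exb.
have [s [s0 sr sr']] := common_radius r0 r'0.
have {exa}[M0 _ ha ca] := expansion_shrink s0 sr exa.
have {exb}[M'0 _ hb cb] := expansion_shrink s0 sr' exb.
have s8 : 0 < s / 8 by rewrite divr_gt0.
apply: (@expansion_analytic _ _ (cauchy_product a b) (s / 8) s8) => y ys.
have ys' : `|y| < s.
  by apply: lt_le_trans ys _; rewrite ler_pdivrMr// ler_peMr ?(ltW s0)// ler1n.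
have e0 : (fun N => psum (cauchy_product a b) y N - psum a y N * psum b y N) @ \oo --> (0 : C).
  apply: (@cvg_pow2_bound _ _ (M * M')); first by rewrite mulr_ge0 ?ltW.
  move=> N; rewrite sub0r opprB; exact: psum_cauchy_product_near (ltW ys).
rewrite (_ : psum _ _ = (fun N => (psum (cauchy_product a b) y N - psum a y N * psum b y N)
    + psum a y N * psum b y N)); last by apply/funext => n; rewrite subrK.
have := seqD_cvg e0 (seqM_cvg (ca y ys') (cb y ys')); rewrite add0r; exact.
Qed.

(** Solves sum_(i <= n) a_i b_(n - i) = 0 for b_n, given the list s of the earlier b_k. *)
Fixpoint inv_coefs a n : seq C :=
  if n is n'.+1 then
    let s := inv_coefs a n' in
    rcons s (if n' is 0%N then (a 0%N)^-1 else
             - (a 0%N)^-1 * \sum_(k < n') a (n' - k)%N * s`_k)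
  else [::].

Definition inv_coef a n := (inv_coefs a n.+1)`_n.

Lemma size_inv_coefs a n : size (inv_coefs a n) = n.
Proof. by elim: n => //= n IH; rewrite size_rcons IH. Qed.

Lemma nth_inv_coefs a n k : (k < n)%N -> (inv_coefs a n)`_k = inv_coef a k.
Proof.
elim: n => // n IH; rewrite ltnS leq_eqVlt => /orP[/eqP->//|kn].
by rewrite /= nth_rcons size_inv_coefs kn IH.
Qed.

Lemma inv_coef0 a : inv_coef a 0 = (a 0%N)^-1. Proof. by []. Qed.

Lemma inv_coefS a n : inv_coef a n.+1 =
  - (a 0%N)^-1 * \sum_(k < n.+1) a (n.+1 - k)%N * inv_coef a k.
Proof.
rewrite {1}/inv_coef.
have -> : inv_coefs a n.+2 = rcons (inv_coefs a n.+1)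
  (- (a 0%N)^-1 * \sum_(k < n.+1) a (n.+1 - k)%N * (inv_coefs a n.+1)`_k) by [].
rewrite nth_rcons size_inv_coefs ltnn eqxx; congr (_ * _).
by apply: eq_bigr => k _; rewrite nth_inv_coefs.
Qed.

Lemma cauchy_product_inv_coef a n : a 0%N != 0 -> cauchy_product a (inv_coef a) n = (n == 0%N)%:R.
Proof.
move=> a0; rewrite /cauchy_product; case: n => [|n].
  by rewrite big_ord_recl big_ord0 addr0 subn0 inv_coef0 mulfV.
rewrite big_ord_recl subn0 inv_coefS mulrA mulrN mulfV// mulN1r.
rewrite [X in - X](reindex_inj rev_ord_inj)/= addrC; apply/eqP; rewrite subr_eq0; apply/eqP.
apply: eq_bigr => i _; rewrite /bump add1n subSS; have := ltn_ord i => ?.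
by congr (a _ * inv_coef a _); lia.
Qed.

(** By induction the n-th coefficient is at most a geometric sum, and the ratio
    1 + q is what makes q (1 + (1 + q) + ... + (1 + q)^(n-1)) at most (1 + q)^n. *)
Lemma inv_coef_bound a M r : 0 < M -> 0 < r -> a 0%N != 0 ->
  (forall n, `|a n| <= M * r ^- n) ->
  let q := M / `|a 0%N| in
  forall n, `|inv_coef a n| <= `|a 0%N|^-1 * ((1 + q) / r) ^+ n.
Proof.
move=> M0 r0 a0 ha q; elim/ltn_ind => -[_|n IH].
  by rewrite inv_coef0 normfV expr0 mulr1.
have n0 : 0 < `|a 0%N| by rewrite normr_gt0.
have q0 : 0 < q by rewrite divr_gt0.
rewrite inv_coefS normrM normrN normfV ler_pM2l ?invr_gt0//.
apply: le_trans (ler_norm_sum _ _ _) _.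
have step (k : 'I_n.+1) : true -> `|a (n.+1 - k)%N * inv_coef a k| <=
    r ^- n.+1 * (q * (1 + q) ^+ k).
  move=> _; rewrite normrM; apply: le_trans (ler_pM _ _ (ha _) (IH _ (ltn_ord k))) _ => //.
  rewrite -[X in _ <= r ^- X * _](subnK (ltnW (ltn_ord k))).
  rewrite exprMn exprVn exprD /q le_eqVlt; apply/orP; left; apply/eqP; field.
  by rewrite !expf_neq0 ?gt_eqF.
apply: le_trans (ler_sum _ step) _; rewrite -mulr_sumr.
rewrite exprMn exprVn [leRHS]mulrC ler_pM2l ?invr_gt0 ?exprn_gt0//.
rewrite -mulr_sumr; have := subrX1 (1 + q) n.+1; rewrite [1 + q - 1]addrC addKr => <-.
by rewrite gerBl.
Qed.

(** The partial sums S_N of g and T_N of the reciprocal series satisfy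
    S_N T_N -> 1, and S_N -> g <> 0, so that T_N = S_N T_N / S_N -> 1 / g. *)
Lemma analytic_inv z g : analytic_at z g -> g z != 0 ->
  analytic_at z (fun x => (g x)^-1).
Proof.
move=> ang gz; have /nbhs_normP[d /= d0 hd] := analytic_near_neq0 ang gz.
have [a [M [r exa]]] := analytic_expansion ang.
have [M0 r0 ha _] := exa; have a0 : a 0%N != 0 by rewrite -(expansion_head exa).
pose q := M / `|a 0%N|; have q0 : 0 < q by rewrite divr_gt0// normr_gt0.
have K0 : 0 < r / (1 + q) by rewrite divr_gt0// addr_gt0.
have Kr : r / (1 + q) <= r.
  by rewrite ler_pdivrMr ?addr_gt0// ler_peMr ?(ltW r0)// lerDl ltW.
have hb n : `|inv_coef a n| <= `|a 0%N|^-1 * (r / (1 + q)) ^- n.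
  by rewrite -exprVn invf_div; exact: inv_coef_bound.
have [s [s0 sr sr']] := common_radius d0 (divr_gt0 K0 (ltr0n C 8)).
have {exa}[_ _ ha' ca] := expansion_shrink K0 Kr exa.
apply: (@expansion_analytic _ _ (inv_coef a) s s0) => y ys.
have ys' : `|y| < r / (1 + q).
  apply: lt_le_trans ys _; apply: le_trans sr' _.
  by rewrite ler_pdivrMr// ler_peMr ?(ltW K0)// ler1n.
have gy : g (z + y) != 0.
  by apply: hd; rewrite /= opprD addNKr normrN; apply: lt_le_trans sr.
have n0 : 0 < `|a 0%N|^-1 by rewrite invr_gt0 normr_gt0.
have e1 : (fun N => psum a y N * psum (inv_coef a) y N) @ \oo --> (1 : C).
  have e0 : (fun N => psum a y N * psum (inv_coef a) y N - psum (cauchy_product a (inv_coef a)) y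
      N) @ \oo --> (0 : C).
    apply: (@cvg_pow2_bound _ _ (M * `|a 0%N|^-1)); first by rewrite mulr_ge0 ?ltW.
    move=> N; rewrite sub0r normrN; apply: (psum_cauchy_product_near _ K0) => //.
    by apply: le_trans sr'; exact: ltW.
  rewrite (_ : (fun N => _) = (fun N => (psum a y N * psum (inv_coef a) y N - psum
      (cauchy_product a (inv_coef a)) y N)
    + psum (cauchy_product a (inv_coef a)) y N)); last by apply/funext => n; rewrite subrK.
  suff e1 : psum (cauchy_product a (inv_coef a)) y @ \oo --> (1 : C).
    by have := seqD_cvg e0 e1; rewrite add0r; exact.
  apply: cvg_near_cst; exists 1%N => // n /= n1; rewrite psumE; case: n n1 => // n _.
  rewrite big_ord_recl cauchy_product_inv_coef// expr0 mulr1 big1 ?addr0// => i _.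
  by rewrite cauchy_product_inv_coef// mul0r.
have e2 := seqM_cvg e1 (seqV_cvg gy (ca y ys')).
rewrite mul1r in e2; apply: cvg_trans e2; apply: near_eq_cvg.
have /cvgrPdist_lt/(_ `|g (z + y)|) := ca y ys'; rewrite normr_gt0 => /(_ gy).
apply: filterS => N hN.
have pn0 : psum a y N != 0.
  by apply/eqP => p0; move: hN; rewrite p0 subr0 ltxx.
by rewrite mulrAC mulfV// mul1r.
Qed.

Lemma analytic_pow z g n : analytic_at z g -> analytic_at z (fun x => g x ^+ n).
Proof.
move=> ag; elim: n => [|n IH].
  by under eq_fun do rewrite expr0; exact: analytic_cst.
by under eq_fun do rewrite exprS; exact: analytic_mul.
Qed.

Lemma analytic_sum z (I : Type) (s : seq I) (F : I -> C -> C) :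
  (forall i, analytic_at z (F i)) -> analytic_at z (fun x => \sum_(i <- s) F i x).
Proof.
move=> hF; elim: s => [|i s IH].
  by under eq_fun do rewrite big_nil; exact: analytic_cst.
by under eq_fun do rewrite big_cons; exact: (analytic_add (hF i) IH).
Qed.

Lemma analytic_horner z (p : {poly C}) : analytic_at z (fun x => p.[x]).
Proof.
under eq_fun do rewrite horner_coef; apply: analytic_sum => i.
apply: analytic_mul; first exact: analytic_cst.
exact/analytic_pow/analytic_id.
Qed.

Lemma analytic_near_eq z g h : (\forall x \near z, g x = h x) ->
  analytic_at z g -> analytic_at z h.
Proof.
by move=> e [a ha]; exists a; apply: filterS2 e ha => x <-.
Qed.

Lemma analytic_powm0 g m : (0 < m)%N -> analytic_at 0 g ->
  analytic_at 0 (fun x => g (x ^+ m)).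
Proof.
move=> m0 /analytic_expansion[a [M [r ex]]]; have [M0 r0 ha ca] := ex.
pose b n := if (m %| n)%N then a (n %/ m)%N else 0.
have [s [s0 s1 sr]] := common_radius (@ltr01 C) r0.
apply: (@expansion_analytic _ _ b s s0) => y ys; rewrite add0r.
have ymr : `|y ^+ m| < r.
  rewrite normrX; case: m m0 {b} => // m _; rewrite exprS.
  apply: le_lt_trans (lt_le_trans ys sr); rewrite ler_piMr// exprn_ile1//.
  by apply: le_trans s1; exact: ltW.
have := ca _ ymr; rewrite add0r => /cvgrPdist_lt cv.
apply/cvgrPdist_lt => e e0; have [N _ hN] := cv e e0.
exists (N * m)%N => // n /= Nn.
(* (n + m.-1) %/ m is the number of multiples of m below n. *)
suff -> : psum b y n = psum a (y ^+ m) ((n + m.-1) %/ m)%N.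
  apply: hN => /=; rewrite leq_divRL//; exact: leq_trans Nn (leq_addr _ _).
elim: n {Nn} => [|n IH].
  by rewrite add0n divn_small ?prednK// !psumE !big_ord0.
rewrite psumE big_ord_recr/= -psumE IH /b; case: ifP => [/dvdnP[k ->]|mn].
  rewrite mulnK// (_ : (k * m).+1 + m.-1 = k.+1 * m)%N; last by lia.
  rewrite mulnK// divnMDl// divn_small ?prednK// addn0.
  by rewrite !psumE big_ord_recr/= -exprM mulnC.
rewrite mul0r addr0; congr (psum _ _ _).
rewrite (divn_eq n m); set k := (n %/ m)%N; set j := (n %% m)%N.
have jm : (j < m)%N by rewrite ltn_mod.
have j0 : (0 < j)%N by rewrite lt0n; apply/negP => /eqP j0; move: mn; rewrite /dvdn -/j j0.
have e1 : (k * m + j + m.-1 = k.+1 * m + j.-1)%N by lia.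
have e2 : ((k * m + j).+1 + m.-1 = k.+1 * m + j)%N by lia.
by rewrite e1 e2 !divnMDl// !divn_small//; lia.
Qed.

(** Isolated zeros: the order is the least index of a nonzero coefficient. *)
Lemma analytic_order g : analytic_at 0 g ->
  (\forall x \near (0 : C), g x = 0) \/
  exists n u, [/\ analytic_at 0 u, u 0 != 0 & \forall x \near (0 : C), g x = x ^+ n * u x].
Proof.
move=> /analytic_expansion[a [M [r ex]]]; have [M0 r0 ha ca] := ex.
have nearr : \forall x \near (0 : C), `|x| < r.
  by apply/nbhs_normP; exists r => // x; rewrite /= distrC subr0.
have [a0|/existsNP/cid[k0 /eqP ak0]] := pselect (forall n, a n = 0).
  left; apply: filterS nearr => x xr.
  have := ca x xr; rewrite add0r => cv.
  apply: (cvg_unique (@norm_hausdorff _ C^o) cv); apply: cvg_near_cst.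
  by exists 0%N => // n _; rewrite psumE big1// => i _; rewrite a0 mul0r.
right; have [n an nmin] := ex_minnP (ex_intro (fun k => a k != 0) k0 ak0).
(* At 0 the quotient is given its limit. *)
pose u x := if x == 0 then a n else x ^- n * g x.
exists n, u; rewrite {2}/u eqxx; split=> //.
  apply: (@expansion_analytic _ _ (fun k => a (k + n)%N) r r0) => y yr; rewrite add0r /u.
  have [->|y0] := eqVneq y 0.
    apply: cvg_near_cst; exists 1%N => // N /= n0; rewrite psumE; case: N n0 => // N _.
    rewrite big_ord_recl expr0 mulr1 add0n big1 ?addr0// => i _.
    by rewrite lift0 expr0n mulr0.
  have := ca y yr; rewrite add0r => cv.
  have cv' : (fun k => psum a y (k + n)%N) @ \oo --> g y.
    exact: (cvg_comp _ _ (cvg_addnr n) cv).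
  have cvk : (fun _ : nat => y ^- n) @ \oo --> y ^- n by exact: cvg_cst.
  have := seqM_cvg cvk cv'.
  rewrite (_ : (fun k => y ^- n * _) = psum (fun k => a (k + n)%N) y)//.
  apply/funext => k; rewrite psumE addnC big_split_ord/= big1 ?add0r; last first.
    move=> i _; apply/eqP; rewrite mulf_eq0; apply/orP; left; apply/negPn/negP => /nmin.
    by rewrite leqNgt ltn_ord.
  rewrite psumE mulr_sumr; apply: eq_bigr => i _.
  by rewrite exprD mulrCA mulKf ?expf_neq0// addnC.
apply: filterS nearr => x xr; rewrite /u; case: eqVneq => [->|x0];
    last by rewrite mulVKf// expf_neq0.
rewrite (_ : g 0 = a 0%N); last by have := expansion_head ex.
case: (n) an nmin => [|n'] an nmin; first by rewrite expr0 mul1r.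
rewrite expr0n mul0r; apply/eqP; apply/negPn/negP => /nmin; by rewrite ltn0.
Qed.

End PowerSeries.

(** * Germs of meromorphic functions at the origin *)

Section Germ.
Variable R : realType.
Local Notation C := (cplx R).
Implicit Types (g h u v : C -> C) (w x y z c : C) (k n : int).

Lemma germ_refl (T : Type) (s : C -> T) : s =~ s.
Proof. exact: nearW. Qed.

Lemma germ_sym (T : Type) (s t : C -> T) : s =~ t -> t =~ s.
Proof. by apply: filterS => w ->. Qed.

Lemma germ_trans (T : Type) (s t p : C -> T) : s =~ t -> t =~ p -> s =~ p.
Proof. by apply: filterS2 => w -> ->. Qed.

Lemma near_punctured (Q : set C) : (\forall w \near (0 : C), Q w) ->
  \forall w \near (0 : C)^', Q w.
Proof. exact: nbhs_dnbhs. Qed.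

Lemma near_neq0 : \forall w \near (0 : C)^', w != 0.
Proof. by apply/nbhs_normP; exists 1 => //= w _; exact. Qed.

Lemma germ_eqW (T : Type) (s t : C -> T) : (forall w, w != 0 -> s w = t w) -> s =~ t.
Proof. by move=> h; apply: filterS near_neq0 => w; exact: h. Qed.

Lemma near_powm (m : nat) (Q : set C) : (0 < m)%N ->
  (\forall w \near (0 : C)^', Q w) -> \forall w \near (0 : C)^', Q (w ^+ m).
Proof.
move=> m0 /nbhs_normP[e /= e0 he].
have [s [s0 s1 se]] := common_radius (@ltr01 C) e0.
apply/nbhs_normP; exists s => // w; rewrite /= distrC subr0 => ws w0.
apply: he; last by rewrite expf_neq0.
rewrite /= distrC subr0 normrX; case: m m0 => // m _; rewrite exprS.
apply: lt_le_trans se; apply: le_lt_trans (ws); rewrite ler_piMr// exprn_ile1//.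
by apply: le_trans s1; exact: ltW.
Qed.

Lemma germ_powm (T : Type) (m : nat) (s t : C -> T) : (0 < m)%N -> s =~ t ->
  (fun w => s (w ^+ m)) =~ (fun w => t (w ^+ m)).
Proof. by move=> m0; exact: (near_powm m0). Qed.

Lemma holoP g : holo g <-> exists2 h, analytic_at 0 h & g =~ h.
Proof.
split=> -[h].
  by move=> [ah gh]; exists h => //; apply: filterS gh => w; rewrite expr0z mul1r.
by move=> ah gh; exists h; split=> //; apply: filterS gh => w; rewrite expr0z mul1r.
Qed.

Lemma holo_germ g h : g =~ h -> holo g -> holo h.
Proof.
by move=> gh /holoP[u au gu]; apply/holoP; exists u => //; apply: germ_trans gu; exact: germ_sym.
Qed.

Lemma analytic_holo g : analytic_at 0 g -> holo g.
Proof. by move=> ag; apply/holoP; exists g => //; exact: germ_refl. Qed.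

Lemma holo_cst c : holo (fun=> c).
Proof. exact/analytic_holo/analytic_cst. Qed.

Lemma holo_id : holo (fun w : C => w).
Proof. exact/analytic_holo/analytic_id. Qed.

Lemma holo_add g h : holo g -> holo h -> holo (fun w => g w + h w).
Proof.
move=> /holoP[u au gu] /holoP[v av hv]; apply/holoP.
exists (fun w => u w + v w); first exact: analytic_add.
by apply: filterS2 gu hv => w -> ->.
Qed.

Lemma holo_mul g h : holo g -> holo h -> holo (fun w => g w * h w).
Proof.
move=> /holoP[u au gu] /holoP[v av hv]; apply/holoP.
exists (fun w => u w * v w); first exact: analytic_mul.
by apply: filterS2 gu hv => w -> ->.
Qed.

Lemma holo_expn g (n : nat) : holo g -> holo (fun w => g w ^+ n).
Proof.
move=> hg; elim: n => [|n IH].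
  by apply: holo_germ (holo_cst 1); apply: germ_eqW.
by apply: holo_germ (holo_mul hg IH); apply: germ_eqW => w _; rewrite exprS.
Qed.

Lemma holo_expz n : 0 <= n -> holo (fun w : C => w ^ n).
Proof. by case: n => // n _; exact: holo_expn holo_id. Qed.

Lemma germOP n g : germO n g <-> holo (fun w => w ^ n * g w).
Proof. by rewrite holoP; split=> -[h]; [move=> [ah gh]|move=> ah gh]; exists h. Qed.

Lemma germO_germ n g h : g =~ h -> germO n g -> germO n h.
Proof.
by move=> gh; rewrite !germOP; apply: holo_germ; apply: filterS gh => w ->.
Qed.

Lemma germO_add n g h : germO n g -> germO n h -> germO n (fun w => g w + h w).
Proof.
rewrite !germOP => hg hh; apply: holo_germ (holo_add hg hh).
by apply: germ_eqW => w _; rewrite mulrDr.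
Qed.

Lemma germO_mul n k g h : germO n g -> germO k h -> germO (n + k) (fun w => g w * h w).
Proof.
rewrite !germOP => hg hh; apply: holo_germ (holo_mul hg hh).
by apply: germ_eqW => w w0; rewrite expfzDr// mulrACA.
Qed.

Lemma germO_mono n k g : n <= k -> germO n g -> germO k g.
Proof.
move=> nk; rewrite !germOP => hg.
have kn : 0 <= k - n by rewrite subr_ge0.
apply: holo_germ (holo_mul (holo_expz kn) hg).
by apply: germ_eqW => w w0; rewrite mulrA -expfzDr// subrK.
Qed.

Lemma germO_expz k : germO (- k) (fun w : C => w ^ k).
Proof.
apply/germOP; apply: holo_germ (holo_cst 1); apply: germ_eqW => w w0.
by rewrite -expfzDr// addNr.
Qed.

Lemma germO_zero n g : g =~ (fun=> 0) -> germO n g.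
Proof.
move=> g0; apply: germO_germ (germ_sym g0) _; apply/germOP.
by apply: holo_germ (holo_cst 0); apply: germ_eqW => w _; rewrite mulr0.
Qed.

Lemma holo_mero g : holo g -> mero g.
Proof. by exists 0. Qed.

Lemma mero_germ g h : g =~ h -> mero g -> mero h.
Proof. by move=> gh [n hn]; exists n; exact: germO_germ hn. Qed.

Lemma mero_cst c : mero (fun=> c).
Proof. exact/holo_mero/holo_cst. Qed.

Lemma mero_add g h : mero g -> mero h -> mero (fun w => g w + h w).
Proof.
move=> [n gn] [k hk]; exists (Num.max n k).
by apply: germO_add; [apply: germO_mono gn|apply: germO_mono hk]; rewrite le_max lexx ?orbT.
Qed.

Lemma mero_mul g h : mero g -> mero h -> mero (fun w => g w * h w).
Proof. by move=> [n gn] [k hk]; exists (n + k); exact: germO_mul. Qed.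

Lemma mero_opp g : mero g -> mero (fun w => - g w).
Proof.
move=> mg; apply: mero_germ (mero_mul (mero_cst (-1)) mg).
by apply: germ_eqW => w _; rewrite mulN1r.
Qed.

Lemma mero_expz k : mero (fun w : C => w ^ k).
Proof. by exists (- k); exact: germO_expz. Qed.

Lemma mero_expn g (n : nat) : mero g -> mero (fun w => g w ^+ n).
Proof.
move=> hg; elim: n => [|n IH].
  by apply: mero_germ (mero_cst 1); apply: germ_eqW.
by apply: mero_germ (mero_mul hg IH); apply: germ_eqW => w _; rewrite exprS.
Qed.

(** The germ w^-k times a unit: a pole of order exactly k, or a zero of order -k. *)
Definition pole k g := exists u, [/\ analytic_at 0 u, u 0 != 0 & g =~ (fun w => w ^ (- k) * u w)].

Lemma pole_germ k g h : g =~ h -> pole k g -> pole k h.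
Proof.
by move=> gh [u [au u0 gu]]; exists u; split=> //; apply: germ_trans gu; exact: germ_sym.
Qed.

Lemma unit_near u : analytic_at 0 u -> u 0 != 0 -> \forall w \near (0 : C)^', u w != 0.
Proof. by move=> au u0; exact/near_punctured/analytic_near_neq0. Qed.

(** Meromorphic germs form a discretely valued field. This dichotomy is the way
    in which membership in lattices is reduced to inequalities of integers. *)
Lemma pole_ex g : mero g -> g =~ (fun=> 0) \/ exists k, pole k g.
Proof.
move=> [n [h [ah gh]]]; have [h0|[j [u [au u0 hu]]]] := analytic_order ah.
  left; apply: filterS3 near_neq0 gh (near_punctured h0) => w w0 gw hw.
  by apply: (mulfI (expfz_neq0 n w0)); rewrite gw hw mulr0.
right; exists (n - j%:Z), u; split=> //.
apply: filterS3 near_neq0 gh (near_punctured hu) => w w0 gw hw.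
apply: (mulfI (expfz_neq0 n w0)); rewrite gw hw mulrA -expfzDr//.
by congr (_ * _); rewrite opprB addrCA subrr addr0.
Qed.

Lemma pole_mero k g : pole k g -> mero g.
Proof.
move=> [u [au _ /germ_sym gu]]; apply: mero_germ gu _.
exact: mero_mul (mero_expz _) (holo_mero (analytic_holo au)).
Qed.

(** A bounded function times w tends to 0. *)
Lemma holo_id_nunit g : holo g -> ~ ((fun w => w * g w) =~ (fun=> 1)).
Proof.
move=> /holoP[h ah gh] e; have [K K0 hK] := analytic_bounded ah.
have nears : \forall w \near (0 : C)^', `|w| < K^-1 by apply: dnbhs0_lt; rewrite invr_gt0.
have [w [h1 h2 h3 h4]] : exists w, [/\ w * g w = 1, g w = h w, `|h w| <= K & `|w| < K^-1].
  apply: (@filter_ex _ (0 : C)^').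
  by apply: filterS2 (filterI e gh) (filterI (near_punctured hK) nears) => w [? ?] [? ?]; split.
have : `|w * g w| < 1.
  rewrite normrM h2; apply: le_lt_trans (ler_wpM2l (normr_ge0 _) h3) _.
  by rewrite -ltr_pdivlMr// mul1r.
by rewrite h1 normr1 ltxx.
Qed.

Lemma pole_germO k g n : pole k g -> germO n g <-> k <= n.
Proof.
move=> [u [au u0 gu]]; split; last first.
  move=> kn; apply: germO_mono kn _; apply: germO_germ (germ_sym gu) _.
  have := germO_mul (germO_expz (- k)) (analytic_holo au : germO 0 u).
  by rewrite addr0 opprK.
move=> /germOP hg; rewrite leNgt; apply/negP => nk.
have j0 : 0 <= k - n - 1 by lia.
have hV : holo (fun w => (u w)^-1) by exact/analytic_holo/analytic_inv.
apply: (holo_id_nunit (holo_mul (holo_expz j0) (holo_mul hg hV))).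
apply: filterS3 near_neq0 gu (unit_near au u0) => w w0 -> uw.
rewrite -{1}[w]expr1z !mulrA -!expfzDr// mulfK// -?expfzDr//.
by rewrite (_ : 1 + (k - n - 1) + n - k = 0); last by ring.
Qed.

Lemma pole_neq0 k g : pole k g -> ~ (g =~ (fun=> 0)).
Proof.
move=> pg g0; have : germO (k - 1) g by exact: germO_zero.
by rewrite (pole_germO _ pg); lia.
Qed.

Lemma pole_uniq k n g : pole k g -> pole n g -> k = n.
Proof.
move=> pk pn; apply/eqP; rewrite eq_le.
apply/andP; split.
  by apply/(pole_germO n pk)/(pole_germO n pn).
by apply/(pole_germO k pn)/(pole_germO k pk).
Qed.

Lemma pole_mul k n g h : pole k g -> pole n h -> pole (k + n) (fun w => g w * h w).
Proof.
move=> [u [au u0 gu]] [v [av v0 hv]]; exists (fun w => u w * v w); split.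
- exact: analytic_mul.
- by rewrite mulf_neq0.
- apply: filterS3 near_neq0 gu hv => w w0 -> ->.
  by rewrite mulrACA -expfzDr// opprD.
Qed.

Lemma pole_inv k g : pole k g -> pole (- k) (fun w => (g w)^-1).
Proof.
move=> [u [au u0 gu]]; exists (fun w => (u w)^-1); split.
- exact: analytic_inv.
- by rewrite invr_eq0.
- by apply: filterS2 near_neq0 gu => w w0 ->; rewrite invfM invr_expz.
Qed.

Lemma mero_inv g : mero g -> mero (fun w => (g w)^-1).
Proof.
move=> /pole_ex[g0|[k pg]]; last exact: pole_mero (pole_inv pg).
by apply: mero_germ (mero_cst 0); apply: filterS g0 => w ->; rewrite invr0.
Qed.

Lemma pole_unit u : analytic_at 0 u -> u 0 != 0 -> pole 0 u.
Proof.
by move=> au u0; exists u; split=> //; apply: germ_eqW => w _; rewrite oppr0 expr0z mul1r.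
Qed.

Lemma pole_cst c : c != 0 -> pole 0 (fun=> c).
Proof. by move=> c0; apply: pole_unit => //; exact: analytic_cst. Qed.

Lemma pole_expz k : pole (- k) (fun w : C => w ^ k).
Proof.
exists (fun=> 1); split; [exact: analytic_cst|exact: oner_neq0|].
by apply: germ_eqW => w _; rewrite opprK mulr1.
Qed.

Lemma pole_powm k g (m : nat) : (0 < m)%N -> pole k g ->
  pole (m%:Z * k) (fun w => g (w ^+ m)).
Proof.
move=> m0 [u [au u0 gu]]; exists (fun w => u (w ^+ m)); split.
- exact: analytic_powm0.
- by rewrite expr0n eqn0Ngt m0.
- apply: filterS2 near_neq0 (germ_powm m0 gu) => w w0 ->.
  by rewrite -mulrN -exprz_exp.
Qed.

(** w^(deg p) p(1/w) is the reversed polynomial, whose value at 0 is the leading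
    coefficient of p. *)
Lemma pole_horner_inv (p : {poly C}) : p != 0 ->
  pole (size p).-1%:Z (fun w => p.[w^-1]).
Proof.
move=> p0; pose q := \poly_(i < size p) p`_((size p).-1 - i).
exists (fun w => q.[w]); split; first exact: analytic_horner.
  by rewrite horner_coef0 coef_poly size_poly_gt0 p0 subn0 -lead_coefE lead_coef_eq0.
apply: germ_eqW => w w0; rewrite horner_poly horner_coef mulr_sumr (reindex_inj rev_ord_inj).
apply: eq_bigr => i _ /=.
have -> : (size p - i.+1 = (size p).-1 - i)%N by lia.
rewrite [RHS]mulrCA; congr (_ * _); rewrite exprVn exprnN (exprnP w i) -expfzDr//.
have key (N j : nat) : (j < N)%N -> - (N.-1 - j)%N%:Z = - N.-1%:Z + j%:Z by lia.
by congr (_ ^ _); exact: key (ltn_ord i).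
Qed.

Lemma mero_horner_inv (p : {poly C}) : mero (fun w => p.[w^-1]).
Proof.
have [->|p0] := eqVneq p 0; last exact: pole_mero (pole_horner_inv p0).
by apply: mero_germ (mero_cst 0); apply: germ_eqW => w _; rewrite horner0.
Qed.

Lemma pole0_holo u : pole 0 u -> holo u.
Proof. by move=> pu; apply/(pole_germO 0 pu). Qed.

Lemma pole_le0_holo k u : pole k u -> k <= 0 -> holo u.
Proof. by move=> pu k0; apply/(pole_germO 0 pu). Qed.

Lemma germO_powm n g (m : nat) : (0 < m)%N -> germO n g ->
  germO (m%:Z * n) (fun w => g (w ^+ m)).
Proof.
move=> m0 [h [ah gh]]; exists (fun w => h (w ^+ m)); split; first exact: analytic_powm0.
by apply: filterS (germ_powm m0 gh) => w <-; rewrite -exprz_exp.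
Qed.

Lemma germO_mero n g : germO n g -> mero g.
Proof. by exists n. Qed.

Lemma mero_not_germO n g : mero g -> ~ germO n g -> exists2 k, pole k g & n < k.
Proof.
move=> /pole_ex[/(@germO_zero n)//|[k pk]] h; exists k => //.
by rewrite ltNge; apply/negP => kn; apply: h; apply/(pole_germO _ pk).
Qed.

Lemma mul_pole_factors k g h : mero g -> mero h -> pole k (fun w => g w * h w) ->
  exists p q, [/\ pole p g, pole q h & k = p + q].
Proof.
move=> /pole_ex[g0|[p pg]] mh pk.
  by exfalso; apply: (pole_neq0 pk); apply: filterS g0 => w ->; rewrite mul0r.
have [h0|[q ph]] := pole_ex mh.
  by exfalso; apply: (pole_neq0 pk); apply: filterS h0 => w ->; rewrite mulr0.
by exists p, q; split=> //; exact: pole_uniq pk (pole_mul pg ph).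
Qed.

Lemma holo_flat g : holo g -> (forall n : nat, germO (- n%:Z) g) -> g =~ (fun=> 0).
Proof.
move=> /holo_mero/pole_ex[//|[k pk]] h; have := h `|k|.+1%N.
by rewrite (pole_germO _ pk); lia.
Qed.

End Germ.

(** * Modules over rings of germs, and filtered bundles *)

Section Modules.
Variable R : realType.
Local Notation C := (cplx R).

(** Both the holomorphic and the meromorphic germs are used as rings of scalars. *)
Record germ_ring (A : set (C -> C)) : Prop := {
  gr_cst : forall c, A (fun=> c) ;
  gr_add : forall g h, A g -> A h -> A (fun w => g w + h w) ;
  gr_mul : forall g h, A g -> A h -> A (fun w => g w * h w) }.

Lemma holo_ring : germ_ring (@holo R).
Proof. split; [exact: holo_cst|exact: holo_add|exact: holo_mul]. Qed.

Lemma mero_ring : germ_ring (@mero R).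
Proof. split; [exact: mero_cst|exact: mero_add|exact: mero_mul]. Qed.

Variable r : nat.
Implicit Types (s t : germs R r) (M L : set (germs R r)) (A : set (C -> C)).

Record germ_submodule A M : Prop := {
  gm_zero : M (fun=> 0) ;
  gm_add : forall s t, M s -> M t -> M (fun w => s w + t w) ;
  gm_scale : forall g s, A g -> M s -> M (fun w => g w *: s w) ;
  gm_germ : forall s t, s =~ t -> M s -> M t }.

Lemma gm_sum A M (I : Type) (l : seq I) (F : I -> germs R r) :
  germ_submodule A M -> (forall i, M (F i)) -> M (fun w => \sum_(i <- l) F i w).
Proof.
move=> mM hF; elim: l => [|i l IH].
  by apply: (gm_germ mM) (gm_zero mM); apply: germ_eqW => w _; rewrite big_nil.
apply: (gm_germ mM) (gm_add mM (hF i) IH); apply: germ_eqW => w _; by rewrite big_cons.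
Qed.

Lemma span_submodule A (X : set (germs R r)) : germ_ring A -> germ_submodule A (span A X).
Proof.
move=> rA; split.
- exists 0%N, (fun=> fun=> 0), (fun=> fun=> 0); split; first by case.
  by apply: germ_eqW => w _; rewrite /lincomb big_ord0.
- move=> s t [k [a [e [h hs]]]] [k' [a' [e' [h' ht]]]].
  pose b (i : 'I_(k + k')) := match fintype.split i with inl j => a j | inr j => a' j end.
  pose d (i : 'I_(k + k')) := match fintype.split i with inl j => e j | inr j => e' j end.
  exists (k + k')%N, b, d; split.
    by move=> i; rewrite /b /d; case: (fintype.split i) => j.
  apply: filterS2 hs ht => w -> ->; rewrite /lincomb big_split_ord/= /b /d.
  congr (_ + _); apply: eq_bigr => i _.
    by rewrite -/(unsplit (inl _)) (unsplitK (inl _ : 'I_k + 'I_k')).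
  by rewrite -/(unsplit (inr _)) (unsplitK (inr _ : 'I_k + 'I_k')).
- move=> g s Ag [k [a [e [h hs]]]]; exists k, (fun i w => g w * a i w), e; split.
    by move=> i; have [? ?] := h i; split=> //; exact: gr_mul.
  apply: filterS hs => w ->; rewrite /lincomb scaler_sumr.
  by apply: eq_bigr => i _; rewrite scalerA.
- move=> s t st [k [a [e [h hs]]]]; exists k, a, e; split=> //.
  by apply: germ_trans hs; exact: germ_sym.
Qed.

Lemma span_incl A (X : set (germs R r)) s : germ_ring A -> X s -> span A X s.
Proof.
move=> rA Xs; exists 1%N, (fun=> fun=> 1), (fun=> s); split.
  by move=> _; split=> //; exact: gr_cst.
by apply: germ_eqW => w _; rewrite /lincomb big_ord1 scale1r.
Qed.

Lemma span_least A (X M : set (germs R r)) : germ_submodule A M -> X `<=` M -> span A X `<=` M.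
Proof.
move=> mM XM s [k [a [e [h hs]]]]; apply: (gm_germ mM (germ_sym hs)).
rewrite /lincomb; apply: (gm_sum (F := fun i w => a i w *: e i w) _ mM) => i.
by have [? ?] := h i; apply: (gm_scale mM) => //; exact: XM.
Qed.

Lemma free_submodule A M : germ_ring A -> free_module A M -> germ_submodule A M.
Proof. by move=> rA [k [e [-> _]]]; exact: span_submodule. Qed.

(** Nakayama for free modules: the coordinates of an element of L = w L = w^2 L = ...
    vanish to infinite order. *)
Lemma free_divisible L : free_module (@holo R) L ->
  (forall s, L s -> exists2 t, L t & s =~ (fun w => w *: t w)) ->
  forall s, L s -> s =~ (fun=> 0).
Proof.
move=> [k [e [LE fr]]] div s Ls.
have coef t : L t -> exists2 a : 'I_k -> C -> C, (forall i, holo (a i)) & t =~ lincomb a e.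
  rewrite LE; apply: (@span_least (@holo R) (range e) [set t | exists2 a : 'I_k -> C -> C,
      (forall i, holo (a i)) & t =~ lincomb a e]).
    split.
    - by exists (fun=> fun=> 0) => [i|]; [exact: holo_cst|apply: germ_eqW => w _;
        rewrite /lincomb big1// => i _; rewrite scale0r].
    - move=> u v [a ha ua] [b hb vb]; exists (fun i w => a i w + b i w).
        by move=> i; exact: holo_add.
      apply: filterS2 ua vb => w -> ->; rewrite /lincomb -big_split/=.
      by apply: eq_bigr => i _; rewrite scalerDl.
    - move=> g u hg [a ha ua]; exists (fun i w => g w * a i w).
        by move=> i; exact: holo_mul.
      apply: filterS ua => w ->; rewrite /lincomb scaler_sumr.
      by apply: eq_bigr => i _; rewrite scalerA.
    - by move=> u v uv [a ha ua]; exists a => //; apply: germ_trans ua; exact: germ_sym.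
  move=> _ [j _ <-]; exists (fun i => fun=> (i == j)%:R); first by move=> i; exact: holo_cst.
  apply: germ_eqW => w _; rewrite /lincomb (bigD1 j)//= eqxx scale1r big1 ?addr0//.
  by move=> i /negPf ->; rewrite scale0r.
have divn n : exists2 t, L t & s =~ (fun w => w ^+ n *: t w).
  elim: n => [|n [t Lt st]].
    by exists s => //; apply: germ_eqW => w _; rewrite expr0 scale1r.
  have [t' Lt' tt'] := div t Lt; exists t' => //.
  by apply: filterS2 st tt' => w -> ->; rewrite scalerA exprSr.
have [a ha sa] := coef s Ls.
suff a0 i : a i =~ (fun=> 0).
  apply: germ_trans sa _; rewrite /lincomb.
  apply: filterS (filter_forall _ a0) => w h; rewrite big1// => i _; by rewrite h scale0r.
apply: holo_flat (ha i) _ => n; have [t Lt st] := divn n; have [b hb tb] := coef t Lt.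
apply: (@germO_germ _ _ (fun w => w ^ n%:Z * b i w)).
  apply: germ_sym.
  have := fr (fun i w => a i w - w ^+ n * b i w).
  have h1 j : holo (fun w => a j w - w ^+ n * b j w).
    apply: holo_germ (holo_add (ha j) (holo_mul (holo_cst (-1)) (holo_mul (holo_expn n (@holo_id
        R)) (hb j)))).
    by apply: germ_eqW => w _; rewrite mulN1r.
  move=> /(_ h1) h2; have {}h2 := h2 _ i; apply: filterS (h2 _).
    by move=> w /eqP; rewrite subr_eq0 => /eqP ->.
  apply: filterS3 sa st tb => w sa st tb.
  rewrite /lincomb; under eq_bigr do rewrite scalerBl -scalerA.
  by rewrite sumrB -scaler_sumr -/(lincomb a e w) -/(lincomb b e w) -sa -tb -st subrr.
by rewrite -[- n%:Z]addr0; apply: germO_mul (germO_expz _ _) (hb i).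
Qed.

Section FilteredBundle.
Variables (E : set (germs R r)) (P : R -> set (germs R r)).
Hypothesis fb : filtered_bundle E P.

Lemma lattice_submodule c : germ_submodule (@holo R) (P c).
Proof. exact: free_submodule holo_ring (fb_lattice fb c). Qed.

Lemma lattice_sub c s : P c s -> E s.
Proof.
move=> Ps; rewrite -(fb_localize fb c); exists 0 => //.
by apply: (gm_germ (lattice_submodule c)) Ps; apply: germ_eqW => w _; rewrite expr0z scale1r.
Qed.

Lemma lattice_germ c s t : s =~ t -> P c s <-> P c t.
Proof.
by move=> st; split; apply: (gm_germ (lattice_submodule c)) => //; exact: germ_sym.
Qed.

Lemma lattice_shift c n s : P (c + n%:~R) s <-> P c (fun w => w ^ n *: s w).
Proof.
have nat_shift (k : nat) a t : P (a + k%:R) t <-> P a (fun w => w ^+ k *: t w).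
  elim: k t => [|k IH] t.
    by rewrite addr0; apply: lattice_germ; apply: germ_eqW => w _; rewrite expr0 scale1r.
  rewrite -addn1 natrD addrA (fb_shift fb) /twist/= IH.
  apply: lattice_germ; apply: germ_eqW => w _; by rewrite expr1z scalerA addn1 exprSr.
case: n => k; first exact: nat_shift.
have := nat_shift k.+1 (c - k.+1%:R) (fun w => w ^ Negz k *: s w); rewrite subrK => ->.
rewrite NegzE intrN; apply: lattice_germ; apply: germ_eqW => w w0.
by rewrite scalerA exprnP -expfzDr// subrr scale1r.
Qed.

Lemma lattice_ex s : E s -> exists c, P c s.
Proof.
rewrite -(fb_localize fb 0) => -[n _]; rewrite /twist/= => h.
by exists (0 + n%:~R); apply/lattice_shift.
Qed.

(** Units do not affect membership in a lattice, and powers of w shift the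
    filtration. *)
Lemma lattice_pole c k g s : pole k g -> P c (fun w => g w *: s w) <-> P (c - k%:~R) s.
Proof.
move=> [u [au u0 gu]]; rewrite -intrN lattice_shift.
split=> h.
  apply: (gm_germ (lattice_submodule c)) (gm_scale (lattice_submodule c) (analytic_holo
      (analytic_inv au u0)) h).
  apply: filterS2 gu (unit_near au u0) => w -> u1.
  by rewrite scalerA mulrCA mulVf// mulr1.
apply: (gm_germ (lattice_submodule c)) (gm_scale (lattice_submodule c) (analytic_holo au) h).
by apply: filterS gu => w ->; rewrite scalerA mulrC.
Qed.

(** Right continuity makes the infimum of the c with s in P_c a minimum. *)
Lemma deg_lattice s : E s -> (exists c, ~ P c s) -> forall c, P c s <-> deg P s <= c.
Proof.
move=> Es [c0 nPc0]; pose S := [set c | P c s].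
have S0 : S !=set0 by have [c hc] := lattice_ex Es; exists c.
have lbS : has_lbound S.
  exists c0 => c Sc; rewrite leNgt; apply/negP => cc0; apply: nPc0.
  exact: (fb_mono fb (ltW cc0)).
have Pd : P (inf S) s.
  rewrite (fb_rcont fb) => a /= da; have [c Sc ca] := inf_lt S0 da.
  exact: (fb_mono fb (ltW ca)).
have nP a : a < inf S -> ~ P a s.
  by move=> ad Pa; move: ad; rewrite ltNge => /negP; apply; exact: ge_inf.
have [Pdeg ndeg] : P (deg P s) s /\ forall a, a < deg P s -> ~ P a s.
  exact: (@xgetPex _ 0 [set c | P c s /\ forall a,
      a < c -> ~ P a s] (ex_intro _ (inf S) (conj Pd nP))).
move=> c; split=> [Pc|dc]; last exact: (fb_mono fb dc).
by rewrite leNgt; apply/negP => /ndeg.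
Qed.

Lemma lattice_line v d : (forall c, P c v <-> d <= c) -> forall c g, mero g ->
  P c (fun w => g w *: v w) <-> germO (Num.floor (c - d)) g.
Proof.
move=> hv c g /pole_ex[g0|[k pk]].
  split=> _.
    exact: germO_zero.
  apply: (gm_germ (lattice_submodule c)) (gm_zero (lattice_submodule c)).
  by apply: filterS g0 => w ->; rewrite scale0r.
rewrite (lattice_pole _ _ pk) hv (pole_germO _ pk) floor_ge_int.
by rewrite lerBrDl -lerBrDr.
Qed.

End FilteredBundle.
End Modules.

(** * Good filtered Higgs bundles and perfect pairings *)

Section Higgs.
Variable R : realType.
Local Notation C := (cplx R).
Variable r : nat.
Implicit Types (s t x y : germs R r) (M L : set (germs R r)).

(** L is one of the lattices in the decomposition of a pulled-back good filtered
    Higgs bundle, with irregular part delta; H is the function to which the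
    eigenvalues l1 H and l2 H of Theta are proportional. *)
Section Projector.
Variables (L : set (germs R r)) (Theta : C -> 'M[C]_r) (H delta : C -> C).
Variables (m : int) (l1 l2 : C).
Hypothesis free : free_module (@holo R) L.
Hypothesis m0 : 0 < m.
Hypothesis poleH : pole m H.
Hypothesis mdelta : mero delta.
Hypothesis l12 : l1 != l2.
Hypothesis logL : forall x, L x ->
  L (fun w => w *: ((Theta w - (delta w)%:M) *m x w)).
Hypothesis cayley : forall w, (Theta w - (l1 * H w)%:M) *m
  ((Theta w - (l2 * H w)%:M) *m (Theta w - (l2 * H w)%:M)) = 0.

Let mL : germ_submodule (@holo R) L := free_submodule (@holo_ring R) free.

(** If the pole of delta is larger than that of H, then w^k Theta acts on L / w L
    as the nonzero scalar v(0), where v = w^k delta, while w^k H acts as 0; the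
    Cayley-Hamilton identity then reads v(0)^3 = 0 on L / w L. *)
Lemma lattice_irregular_zero k : pole k delta -> m < k -> forall x, L x -> x =~ (fun=> 0).
Proof.
move=> pd mk; pose v w := w ^ k * delta w.
have pv : pole 0 v by have := pole_mul (pole_expz R k) pd; rewrite addNr.
have step l y : L y -> exists2 z, L z &
    (fun w => w ^ k *: ((Theta w - (l * H w)%:M) *m y w)) =~ (fun w => v w *: y w + w *: z w).
  move=> Ly; exists (fun w => w ^ (k - 2) *: (w *: ((Theta w - (delta w)%:M) *m y w))
     + (- l * (w ^ (k - 1) * H w)) *: y w).
    apply: (gm_add mL); apply: (gm_scale mL) => //.
    - by apply: holo_expz; lia.
    - exact: logL.
    - apply: holo_mul (holo_cst _) _.
      by apply: pole_le0_holo (pole_mul (pole_expz _ _) poleH) _; lia.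
  apply: germ_eqW => w w0; rewrite scalerDr !scalerA !mulmxBl !mul_scalar_mx !scalerBr !scalerA.
  have wS j : w ^ j = w * w ^ (j - 1).
    by rewrite -[X in _ = X * _]expr1z -expfzDr// addrC subrK.
  have -> : w * (w ^ (k - 2) * w) = w ^ k.
    by rewrite (wS k) (wS (k - 1)) -addrA; ring.
  have -> : w * (- l * (w ^ (k - 1) * H w)) = - (w ^ k * (l * H w)).
    by rewrite (wS k); ring.
  by rewrite /v scaleNr [RHS]addrA; congr (_ - _); rewrite [RHS]addrC subrK.
apply: (free_divisible free) => x Lx.
have [z1 Lz1 e1] := step l2 x Lx.
(* Applying step to l2, l2 and l1 turns the identity for Theta into v^3 x = - w S
   with S in L. *)
pose N l y := fun w => w ^ k *: ((Theta w - (l * H w)%:M) *m y w).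
have hw : holo (fun w : C => w) by exact: holo_id.
have hv : holo v := pole0_holo pv.
have LN l y : L y -> L (N l y).
  move=> Ly; have [z Lz e] := step l y Ly.
  apply: (gm_germ mL (germ_sym e)); apply: (gm_add mL); exact: (gm_scale mL).
have [z2 Lz2 e2] := step l2 _ (LN l2 x Lx).
have [z3 Lz3 e3] := step l1 _ (LN l2 _ (LN l2 x Lx)).
have pv3 : pole 0 (fun w => (v w * (v w * v w))^-1).
  by have := pole_inv (pole_mul pv (pole_mul pv pv)); rewrite !addr0 oppr0.
exists (fun w => - (v w * (v w * v w))^-1 *: (v w *: (v w *: z1 w) + (v w *: z2 w + z3 w))).
  apply: (gm_scale mL); first by apply: holo_germ (holo_mul (holo_cst (-1)) (pole0_holo pv3));
      apply: germ_eqW => w _; rewrite mulN1r.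
  apply: (gm_add mL); first by do 2 apply: (gm_scale mL) => //.
  by apply: (gm_add mL) => //; apply: (gm_scale mL).
have [u [au u0 vu]] := pv.
apply: filterS2 (filterI e1 e2) (filterI e3 (filterI vu (unit_near au u0))) =>
    w [h1 h2] [h3 [h4 h5]].
have v0 : v w != 0 by rewrite h4 oppr0 expr0z mul1r.
have NNN : N l1 (N l2 (N l2 x)) w = 0.
  by rewrite /N -!scalemxAr !mulmxA -(mulmxA _ _ (Theta w - (l2 * H w)%:M)) cayley mul0mx !scaler0.
have e : v w * (v w * v w) *: x w
    + w *: (v w *: (v w *: z1 w) + (v w *: z2 w + z3 w)) = 0.
  rewrite -NNN (h3 : N l1 (N l2 (N l2 x)) w = _) (h2 : N l2 (N l2 x) w = _) (h1 : N l2 x w = _).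
  move: (v w) (x w) (z1 w) (z2 w) (z3 w) => V X Z1 Z2 Z3.
  rewrite !scalerDr !scalerA !addrA; congr (_ + _); congr (_ + _).
    by congr (_ + _); congr (_ *: _); ring.
  by congr (_ *: _); ring.
have v3 : v w * (v w * v w) != 0 by do 2 apply: mulf_neq0 => //.
move: e; set S := (v w *: (v w *: z1 w) + _) => e.
apply: (scalerI v3); rewrite !scalerA [X in _ = X *: _](_ : _ = - w); last by field.
rewrite scaleNr.
by apply/eqP; rewrite -subr_eq0 opprK; apply/eqP.
Qed.

(** The operator is the projection onto the eigenspace of l1 H along the
    generalized eigenspace of l2 H. *)
Lemma projector_lattice x : L x ->
  L (fun w => ((l1 - l2) * H w) ^- 2 *:
    ((Theta w - (l2 * H w)%:M) *m ((Theta w - (l2 * H w)%:M) *m x w))).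
Proof.
move=> Lx.
have [[k pd mk]|dm] : (exists2 k, pole k delta & m < k) \/ germO m delta.
    have [d0|[k pk]] := pole_ex mdelta.
      by right; exact: germO_zero.
    have [km|mk] := leP k m; last by left; exists k.
    by right; apply/(pole_germO _ pk).
  apply: (gm_germ mL) (Lx); apply: germ_trans (lattice_irregular_zero pd mk Lx) _.
  by apply: filterS (lattice_irregular_zero pd mk Lx) => w ->; rewrite !mulmx0 scaler0.
have step y : L y -> L (fun w => w ^ m *: ((Theta w - (l2 * H w)%:M) *m y w)).
  move=> Ly.
  have h1 : L (fun w => w ^ (m - 1) *: (w *: ((Theta w - (delta w)%:M) *m y w))).
    by apply: (gm_scale mL); [apply: holo_expz; lia|exact: logL].
  have h2 : L (fun w => (w ^ m * delta w + (- l2) * (w ^ m * H w)) *: y w).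
    have hH : holo (fun w => w ^ m * H w).
      by apply: pole_le0_holo (pole_mul (pole_expz _ _) poleH) _; rewrite addNr.
    apply: (gm_scale mL) => //; move/germOP: dm => hd.
    exact: (holo_add hd (holo_mul (holo_cst _) hH)).
  apply: (gm_germ mL) (gm_add mL h1 h2); apply: germ_eqW => w w0.
  rewrite scalerA (_ : w ^ (m - 1) * w = w ^ m); last first.
    by rewrite -{2}[w]expr1z -expfzDr// subrK.
  rewrite !mulmxBl !mul_scalar_mx !scalerBr scalerDl mulNr scaleNr !scalerA addrA subrK.
  by congr (_ - _ *: _); ring.
have pu : pole 0 (fun w => (w ^ m * H w)^-1).
  by have := pole_inv (pole_mul (pole_expz R m) poleH); rewrite addNr oppr0.
have l0 : l1 - l2 != 0 by rewrite subr_eq0.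
have hc : holo (fun w => (l1 - l2) ^- 2 * (w ^ m * H w)^-1 ^+ 2).
  by apply: holo_mul (holo_cst _) (holo_expn _ (pole0_holo pu)).
apply: (gm_germ mL) (gm_scale mL hc (step _ (step _ Lx))); apply: germ_eqW => w w0.
rewrite -scalemxAr !scalerA; congr (_ *: _).
have [Hw|Hw] := eqVneq (H w) 0; first by rewrite Hw !mulr0 invr0 !expr0n/= mulr0 !mul0r invr0.
have ww : w ^ m != 0 by rewrite expfz_neq0.
by field; rewrite l0 Hw.
Qed.

End Projector.

Section Pairing.
Variables (G : 'M[C]_r).
Let gr : C -> 'M[C]_r := fun=> G.

Lemma pairing_addl s t x w : pairing gr (fun w =>
    s w + t w) x w = pairing gr s x w + pairing gr t x w.
Proof. by rewrite /pairing linearD/= !mulmxDl mxE. Qed.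

Lemma pairing_addr s t x w : pairing gr x (fun w =>
    s w + t w) w = pairing gr x s w + pairing gr x t w.
Proof. by rewrite /pairing mulmxDr mxE. Qed.

Lemma pairing_scalel (g : C -> C) s x w : pairing gr (fun w =>
    g w *: s w) x w = g w * pairing gr s x w.
Proof. by rewrite /pairing linearZ/= -!scalemxAl mxE. Qed.

Lemma pairing_scaler (g : C -> C) s x w : pairing gr x (fun w =>
    g w *: s w) w = g w * pairing gr x s w.
Proof. by rewrite /pairing -!scalemxAr mxE. Qed.

Lemma pairing_germ s t x y : s =~ t -> x =~ y -> pairing gr s x =~ pairing gr t y.
Proof. by apply: filterS2 => w e1 e2; rewrite /pairing e1 e2. Qed.

Lemma pairing_germO_submodule n t :
  germ_submodule (@holo R) [set s | germO n (pairing gr s t)].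
Proof.
split=> /=.
- by apply: germO_zero; apply: germ_eqW => w _; rewrite /pairing trmx0 !mul0mx mxE.
- move=> s s' h h'; apply: germO_germ (germO_add h h').
  by apply: germ_eqW => w _; rewrite pairing_addl.
- move=> g s hg h; rewrite -[n]add0r; apply: germO_germ (germO_mul (hg : germO 0 g) h).
  by apply: germ_eqW => w _; rewrite pairing_scalel.
- by move=> s s' ss h; apply: germO_germ h; apply: pairing_germ => //; exact: germ_refl.
Qed.

Section Perfect.
Variables (E : set (germs R r)) (P : R -> set (germs R r)) (Theta : C -> 'M[C]_r).
Hypothesis fb : filtered_bundle E P.
Hypothesis sp : symmetric_pairing E P Theta gr.
Hypothesis pp : perfect_pairing E P gr.

Lemma pairing_in_dual s : E s -> in_dual E (pairing gr s).
Proof.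
move=> Es; split=> [t Et|t t' Et Et' tt'|h t t' _ _ _].
- exact: (sp_mero sp).
- by apply: pairing_germ => //; exact: germ_refl.
- by apply: germ_eqW => w _; rewrite pairing_addr pairing_scaler.
Qed.

(** The form in which perfectness is used: P_c is its own dual. *)
Lemma perfect_lattice c s : E s ->
  P c s <-> (forall a t, P a t -> germO (Num.floor (a + c)) (pairing gr s t)).
Proof.
move=> Es; rewrite (pp_filt pp c Es); split=> [[_ h]//|h].
by split=> //; exact: pairing_in_dual.
Qed.

(** Membership in the pulled-back filtration can be tested downstairs: a germ of
    pole order k pulls back to one of pole order m k, and the pairings with
    pulled-back germs have poles of order at most m (a + c). *)
Lemma pullback_filt_descent (m : nat) c s : (0 < m)%N -> E s ->
  pullback_filt m P (m%:R * c) (fun zeta => s (zeta ^+ m)) -> P c s.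
Proof.
move=> m0 Es hs; apply/(perfect_lattice c Es) => a t Pat.
have [g0|[k pk]] := pole_ex (sp_mero sp Es (lattice_sub fb Pat)).
  exact: germO_zero.
apply/(pole_germO _ pk); rewrite floor_ge_int.
have m0R : 0 < m%:R :> R by rewrite ltr0n.
have /(pole_germO _ (pole_powm m0 pk)) :
    germO (Num.floor (m%:R * (a + c))) (pairing gr (fun z => s (z ^+ m)) (fun z => t (z ^+ m))).
  apply: (span_least (pairing_germO_submodule _ _) _ hs) => tau [a' [n [an htau]]].
  have h1 : germO (m%:Z * Num.floor (a' + a))
      (pairing gr (fun w => w ^ n *: tau w) (fun z => t (z ^+ m))).
    apply: (span_least (pairing_germO_submodule _ _) _ htau) => _ [s' Ps' <-].
    exact: (germO_powm m0 (sp_filt sp (lexx _) Ps' Pat)).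
  apply: (@germO_mono _ (n + m%:Z * Num.floor (a' + a))).
    rewrite floor_ge_int intrD intrM mulrDr.
    have := ge_floor (a' + a); rewrite -(ler_pM2l m0R) mulrDr => h.
    by rewrite -[m%:Z%:~R]/(m%:R); lra.
  have h2 := germO_mul (germO_expz R (- n)) h1; rewrite opprK in h2.
  apply: germO_germ h2; apply: germ_eqW => w w0.
  by rewrite pairing_scalel mulrA -expfzDr// addNr expr0z mul1r.
by rewrite floor_ge_int intrM ler_pM2l.
Qed.

End Perfect.
End Pairing.
End Higgs.

(** * The Higgs field and the pairing at a point *)

Section Theta.
Variable R : realType.
Local Notation C := (cplx R).
Implicit Types (t h a b c : C) (x y : 'cV[C]_3).

Lemma pow2D (u v : R) : pow2 (u + v) = pow2 u * pow2 v.
Proof. by rewrite /pow2 powRD ?pnatr_eq0 ?implybT// rmorphM. Qed.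

Lemma pow2_neq0 (u : R) : pow2 u != 0.
Proof. by rewrite /pow2 -[0]/(0%:C)%C (inj_eq (@complexI _)) gt_eqF// powR_gt0. Qed.

Lemma pow2_1 : pow2 1 = 2 :> C.
Proof. by rewrite /pow2 powRr1// -[2 in RHS](rmorph_nat (real_complex R)). Qed.

(** The coefficients of s1, s2, s3 and theta become rational numbers when
    expressed through t = h / 2^(1/3) instead of h. *)
Definition cbrt2 : C := pow2 (1 / 3).

Lemma pow2N1 : pow2 (- 1) = 2^-1 :> C.
Proof.
by apply: (mulfI (pow2_neq0 1)); rewrite -pow2D subrr pow2_1 mulfV// /pow2 powRr0.
Qed.

Lemma pow2_23 h : pow2 (2 / 3) * h = 2 * (h / cbrt2).
Proof.
apply: (mulIf (pow2_neq0 (1 / 3))); rewrite -!mulrA mulVf ?pow2_neq0// mulr1 mulrCA -pow2D.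
by rewrite -pow2_1 mulrC; congr (pow2 _ * _); field.
Qed.

Lemma pow2_N13 h : pow2 (- (1 / 3)) * h = h / cbrt2.
Proof.
apply: (mulIf (pow2_neq0 (1 / 3))); rewrite -!mulrA mulVf ?pow2_neq0// mulr1 mulrCA -pow2D.
by rewrite addNr /pow2 powRr0 mulr1.
Qed.

Lemma cbrt2E3 : cbrt2 ^+ 3 = 2.
Proof. by rewrite !exprS expr0 mulr1 /cbrt2 -!pow2D -pow2_1; congr pow2; field. Qed.

Lemma pow2_N53 h : pow2 (- (5 / 3)) * h ^+ 2 = (h / cbrt2) ^+ 2 / 2.
Proof.
have c0 : cbrt2 != 0 := pow2_neq0 _.
apply: (mulIf (expf_neq0 2 c0)); rewrite expr_div_n [RHS]mulrAC divfK ?expf_neq0//.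
rewrite mulrAC -pow2N1 [RHS]mulrC; congr (_ * _).
by rewrite exprS expr1 /cbrt2 -!pow2D; congr pow2; field.
Qed.

Definition theta_at t : 'M[C]_3 := theta_mx (3 / 2 * t ^+ 2) (2 * t ^+ 3).
Definition s1_at t : 'cV[C]_3 := col3 (5 / 2 * t ^+ 2) (2 * t) 1.
Definition v2_at t : 'cV[C]_3 := col3 (- (t ^+ 2 / 2)) (- t) 1.
Definition s3_at t : 'cV[C]_3 := col3 (- (2 * t)) 1 0.
(** As C(s3, s3) = 1 and C(s2, s3) = - 3 t, this is v3. *)
Definition v3_at t : 'cV[C]_3 := s3_at t + (6 * t)^-1 *: v2_at t.
Definition dot x y : C := (x^T *m @gram R *m y) 0 0.

Lemma theta_atE h : theta h = theta_at (h / cbrt2).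
Proof.
rewrite /theta /theta_at; congr theta_mx.
  by rewrite /q2 -mulrA pow2_N53; field; exact: pow2_neq0.
by rewrite /q3 expr_div_n cbrt2E3 mulrC divfK// -(natr2 C) pnatr_eq0.
Qed.

Lemma col3E x : x = col3 (x 0 0) (x 1 0) (x 2 0).
Proof.
apply/matrixP => i j; rewrite ord1 !mxE; case: i => [[|[|[|//]]]] hi /=;
 by congr (x _ _); apply/val_inj.
Qed.

Lemma theta_col3 t a b c : theta_at t *m col3 a b c =
  col3 (3 / 2 * t ^+ 2 * b + 2 * t ^+ 3 * c) (a + 3 / 2 * t ^+ 2 * c) b.
Proof.
apply/matrixP => i j; rewrite !mxE !big_ord_recl big_ord0 !mxE.
by case: i => [[|[|[|]]]] //= _; ring.
Qed.

Lemma add_col3 a b c a' b' c' : col3 a b c + col3 a' b' c' = col3 (a + a') (b + b') (c + c').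
Proof. by apply/matrixP => i j; rewrite !mxE; case: i => [[|[|[|]]]]. Qed.

Lemma opp_col3 a b c : - col3 a b c = col3 (- a) (- b) (- c).
Proof. by apply/matrixP => i j; rewrite !mxE; case: i => [[|[|[|]]]]. Qed.

Lemma scale_col3 k a b c : k *: col3 a b c = col3 (k * a) (k * b) (k * c).
Proof. by apply/matrixP => i j; rewrite !mxE; case: i => [[|[|[|]]]]. Qed.

Lemma dot_col3 a b c a' b' c' : dot (col3 a b c) (col3 a' b' c') = a * c' + b * b' + c * a'.
Proof.
rewrite /dot !mxE !big_ord_recl big_ord0 !mxE !big_ord_recl !big_ord0 !mxE /=; ring.
Qed.

Definition col3_simp := (theta_col3, scale_col3, opp_col3, add_col3, dot_col3).

Lemma dotC x y : dot x y = dot y x.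
Proof. by rewrite (col3E x) (col3E y) !dot_col3; ring. Qed.

Lemma dotDl x y z : dot (x + y) z = dot x z + dot y z.
Proof. by rewrite (col3E x) (col3E y) (col3E z) !col3_simp; ring. Qed.

Lemma dotZl k x y : dot (k *: x) y = k * dot x y.
Proof. by rewrite (col3E x) (col3E y) !col3_simp; ring. Qed.

Lemma dot11 t : dot (s1_at t) (s1_at t) = 9 * t ^+ 2.
Proof. by rewrite dot_col3; field. Qed.
Lemma dot12 t : dot (s1_at t) (v2_at t) = 0.
Proof. by rewrite dot_col3; field. Qed.
Lemma dot13 t : t != 0 -> dot (s1_at t) (v3_at t) = 0.
Proof. by move=> t0; rewrite /v3_at !col3_simp; field. Qed.
Lemma dot22 t : dot (v2_at t) (v2_at t) = 0.
Proof. by rewrite dot_col3; field. Qed.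
Lemma dot23 t : t != 0 -> dot (v2_at t) (v3_at t) = - (3 * t).
Proof. by move=> t0; rewrite /v3_at !col3_simp; field. Qed.
Lemma dot33 t : t != 0 -> dot (v3_at t) (v3_at t) = 0.
Proof. by move=> t0; rewrite /v3_at !col3_simp; field. Qed.

Definition coord1 t x := dot x (s1_at t) / (9 * t ^+ 2).
Definition coord2 t x := - (dot x (v3_at t) / (3 * t)).
Definition coord3 t x := - (dot x (v2_at t) / (3 * t)).

Lemma coords t x : t != 0 -> x = coord1 t x *: s1_at t + (coord2 t x *: v2_at t + coord3 t x *:
    v3_at t).
Proof.
move=> t0; rewrite /coord1 /coord2 /coord3 (col3E x) /v3_at !col3_simp.
by congr col3; field.
Qed.

Lemma coords_uniq t a b c : t != 0 -> let x := a *: s1_at t + (b *: v2_at t + c *: v3_at t) in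
  [/\ coord1 t x = a, coord2 t x = b & coord3 t x = c].
Proof.
move=> t0 x; rewrite /coord1 /coord2 /coord3 /x !dotDl !dotZl dot11 dot12 dot22 ?dot13 ?dot33
    ?dot23//.
by rewrite (dotC (v2_at t) (s1_at t)) (dotC (v3_at t) (s1_at t)) (dotC (v3_at t) (v2_at t)) dot12
    ?dot13 ?dot23//; split; field.
Qed.

(** v2 and v3 span a Jordan block: (theta + t) v2 = 0 and (theta + t) v3 = v2. *)
Lemma theta_ker1 t x : t != 0 -> (theta_at t - (2 * t)%:M) *m x =
  (coord3 t x - 3 * t * coord2 t x) *: v2_at t - (3 * t * coord3 t x) *: v3_at t.
Proof.
move=> t0; rewrite /coord2 /coord3 (col3E x) /v3_at !(mulmxBl, mul_scalar_mx, col3_simp).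
by congr col3; field.
Qed.

(** (theta + t)^2 is 9 t^2 times the projection onto the line of s1. *)
Lemma theta_ker3 t x : t != 0 -> (theta_at t - (- t)%:M) *m ((theta_at t - (- t)%:M) *m x)
   = (9 * t ^+ 2 * coord1 t x) *: s1_at t.
Proof.
move=> t0; rewrite /coord1 (col3E x) !(mulmxBl, mul_scalar_mx, col3_simp).
by congr col3; field.
Qed.

Lemma theta_cayley t : (theta_at t - (2 * t)%:M) *m
  ((theta_at t - (- t)%:M) *m (theta_at t - (- t)%:M)) = 0.
Proof.
set A := (X in X = 0); suff h x : A *m x = 0.
  by apply/matrixP => i j; have := h (delta_mx j 0); rewrite -colE => /matrixP/(_ i 0);
      rewrite !mxE.
rewrite /A -!mulmxA (col3E x) !(mulmxBl, mul_scalar_mx, col3_simp).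
rewrite [RHS](_ : _ = col3 0 0 0); first by congr col3; field.
by apply/matrixP => i j; rewrite !mxE; case: i => [[|[|[|]]]].
Qed.

End Theta.

(** * The frame of the bundle at infinity *)

Section Stalk.
Variable R : realType.
Local Notation C := (cplx R).
Variable f : {poly C}.
Hypothesis f0 : f != 0.
Implicit Types (s t : germs R 3).

(** The eigenvalues of theta near infinity are 2 tau_oo dw and - tau_oo dw. *)
Definition tau_oo (w : C) : C := foo f w / cbrt2 R.

Lemma cbrt2_neq0 : cbrt2 R != 0. Proof. exact: pow2_neq0. Qed.

Lemma s1E w : s1 f w = s1_at (tau_oo w).
Proof.
rewrite /s1 /s1_at /tau_oo -(pow2_23 (foo f w)) -mulrA pow2_N53; congr col3; by field;
    exact: pow2_neq0.
Qed.

Lemma v2E w : v2 f w = v2_at (tau_oo w).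
Proof. by rewrite /v2 /s2 /v2_at /tau_oo !mulNr pow2_N53 pow2_N13. Qed.

Lemma s3E w : s3 f w = s3_at (tau_oo w).
Proof. by rewrite /s3 /s3_at /tau_oo !mulNr pow2_23. Qed.

Lemma v3E w : tau_oo w != 0 -> v3 f w = v3_at (tau_oo w).
Proof.
move=> t0; rewrite /v3 s3E -/(v2 f w) v2E /v3_at; congr (_ + _); rewrite -scaleNr; congr (_ *: _).
rewrite /pairing s3E -/(v2 f w) v2E /gramC -!/(dot _ _) !col3_simp; field.
rewrite t0/= (_ : _ + _ = - 6 * tau_oo w); last by ring.
by rewrite mulf_neq0// oppr_eq0 pnatr_eq0.
Qed.

(** This is deg f + 2: dz = - w^-2 dw contributes 2, and size f = deg f + 1. *)
Definition infty_order : int := (size f)%:Z + 1.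

Lemma pole_foo : pole infty_order (foo f).
Proof.
have h := pole_mul (pole_mul (pole_cst (_ : (-1 : C) != 0)) (pole_expz R (- 2))) (pole_horner_inv
    f0).
have := h; rewrite oppr_eq0 oner_eq0 => /(_ isT).
rewrite (_ : 0 - - 2 + (size f).-1%:Z = infty_order); last first.
  by rewrite /infty_order; move: f0; rewrite -size_poly_gt0; lia.
apply: pole_germ; apply: germ_eqW => w _; rewrite /foo; congr (_ * _).
by rewrite mulN1r.
Qed.

Lemma pole_tau : pole infty_order tau_oo.
Proof.
have := pole_mul pole_foo (pole_cst (_ : (cbrt2 R)^-1 != 0)).
by rewrite invr_eq0 cbrt2_neq0 addr0; apply.
Qed.

Lemma tau_near0 : \forall w \near (0 : C)^', tau_oo w != 0.
Proof.
have [u [au u0 tu]] := pole_tau.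
apply: filterS3 (near_neq0 R) tu (unit_near au u0) => w w0 tw uw.
by rewrite tw mulf_neq0// expfz_neq0.
Qed.

Lemma coords_germ s : s =~ (fun w => coord1 (tau_oo w) (s w) *: s1 f w
   + (coord2 (tau_oo w) (s w) *: v2 f w + coord3 (tau_oo w) (s w) *: v3 f w)).
Proof.
by apply: filterS tau_near0 => w t0; rewrite s1E v2E v3E// -coords.
Qed.

Definition mero_entries s := forall i, mero (fun w => s w i 0).

Lemma mero_entries_submodule : germ_submodule (@mero R) mero_entries.
Proof.
split=> [i|s t hs ht i|g s hg hs i|s t st hs i].
- by apply: mero_germ (mero_cst 0); apply: germ_eqW => w _; rewrite mxE.
- by apply: mero_germ (mero_add (hs i) (ht i)); apply: germ_eqW => w _; rewrite mxE.
- by apply: mero_germ (mero_mul hg (hs i)); apply: germ_eqW => w _; rewrite mxE.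
- by apply: mero_germ (hs i); apply: filterS st => w ->.
Qed.

Lemma mero_tau : mero tau_oo. Proof. exact: pole_mero pole_tau. Qed.

Lemma mero_col3 (a b c : C -> C) : mero a -> mero b -> mero c ->
  mero_entries (fun w => col3 (a w) (b w) (c w)).
Proof.
move=> ha hb hc [[|[|[|//]]]] hi.
- by apply: mero_germ ha; apply: germ_eqW => w _; rewrite mxE.
- by apply: mero_germ hb; apply: germ_eqW => w _; rewrite mxE.
- by apply: mero_germ hc; apply: germ_eqW => w _; rewrite mxE.
Qed.

Lemma mero_s1 : mero_entries (s1 f).
Proof.
rewrite (_ : s1 f = fun w => s1_at (tau_oo w)); last by apply/funext => w; rewrite s1E.
apply: mero_col3.
- exact: mero_mul (mero_cst _) (mero_expn _ mero_tau).
- exact: mero_mul (mero_cst _) mero_tau.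
- exact: mero_cst.
Qed.

Lemma mero_v2 : mero_entries (v2 f).
Proof.
rewrite (_ : v2 f = fun w => v2_at (tau_oo w)); last by apply/funext => w; rewrite v2E.
apply: mero_col3.
- exact: mero_opp (mero_mul (mero_expn _ mero_tau) (mero_cst _)).
- exact: mero_opp mero_tau.
- exact: mero_cst.
Qed.

Lemma mero_s3 : mero_entries (s3 f).
Proof.
rewrite (_ : s3 f = fun w => s3_at (tau_oo w)); last by apply/funext => w; rewrite s3E.
apply: mero_col3.
- exact: mero_opp (mero_mul (mero_cst _) mero_tau).
- exact: mero_cst.
- exact: mero_cst.
Qed.

Lemma mero_v3 : mero_entries (v3 f).
Proof.
apply: (gm_germ mero_entries_submodule) (gm_add mero_entries_submodule mero_s3
  (gm_scale mero_entries_submodule (mero_inv (mero_mul (mero_cst 6) mero_tau)) mero_v2)).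
by apply: filterS tau_near0 => w t0; rewrite (v3E t0) s3E v2E.
Qed.

Lemma mero_pairing s t : mero_entries s -> mero_entries t ->
  mero (pairing (@gramC R) s t).
Proof.
move=> hs ht.
apply: (mero_germ _ (mero_add (mero_add (mero_mul (hs 0) (ht 2)) (mero_mul (hs 1) (ht 1)))
  (mero_mul (hs 2) (ht 0)))).
apply: germ_eqW => w _; rewrite /pairing -/(dot _ _).
by rewrite (col3E (s w)) (col3E (t w)) dot_col3 !mxE.
Qed.

Lemma coord1E s w : coord1 (tau_oo w) (s w) = pairing (@gramC R) s (s1 f) w / (9 * tau_oo w ^+ 2).
Proof. by rewrite /coord1 /pairing s1E. Qed.
Lemma coord2E s : (fun w => coord2 (tau_oo w) (s w)) =~ (fun w =>
    - (pairing (@gramC R) s (v3 f) w / (3 * tau_oo w))).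
Proof. by apply: filterS tau_near0 => w t0; rewrite /coord2 /pairing v3E. Qed.
Lemma coord3E s w : coord3 (tau_oo w) (s w) = - (pairing (@gramC R) s (v2 f) w / (3 * tau_oo w)).
Proof. by rewrite /coord3 /pairing v2E. Qed.

Lemma mero_coord1 s : mero_entries s -> mero (fun w => coord1 (tau_oo w) (s w)).
Proof.
move=> hs; under eq_fun do rewrite coord1E.
apply: mero_mul (mero_pairing hs mero_s1) (mero_inv (mero_mul (mero_cst _) (mero_expn _ mero_tau))).
Qed.

Lemma mero_coord2 s : mero_entries s -> mero (fun w => coord2 (tau_oo w) (s w)).
Proof.
move=> hs; apply: mero_germ (germ_sym (coord2E s)) _.
apply: mero_opp (mero_mul (mero_pairing hs mero_v3) (mero_inv (mero_mul (mero_cst _) mero_tau))).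
Qed.

Lemma mero_coord3 s : mero_entries s -> mero (fun w => coord3 (tau_oo w) (s w)).
Proof.
move=> hs; under eq_fun do rewrite coord3E.
apply: mero_opp (mero_mul (mero_pairing hs mero_v2) (mero_inv (mero_mul (mero_cst _) mero_tau))).
Qed.

Let Esub : germ_submodule (@mero R) (Etilde_oo f) := span_submodule _ (mero_ring R).

Lemma Etilde_s1 : Etilde_oo f (s1 f).
Proof. by apply: span_incl (mero_ring R) _; left; left. Qed.
Lemma Etilde_v2 : Etilde_oo f (v2 f).
Proof. by apply: span_incl (mero_ring R) _; left; right. Qed.
Lemma Etilde_v3 : Etilde_oo f (v3 f).
Proof.
have h3 : Etilde_oo f (s3 f) by apply: span_incl (mero_ring R) _; right.
apply: (gm_germ Esub) (gm_add Esub h3 (gm_scale Esub (mero_inv (mero_mul (mero_cst 6) mero_tau))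
    Etilde_v2)).
by apply: filterS tau_near0 => w t0; rewrite (v3E t0) s3E v2E.
Qed.

(** The frame s1, s2, s3 and its inverse are meromorphic. *)
Lemma Etilde_ooP s : Etilde_oo f s <-> mero_entries s.
Proof.
split; first apply: (span_least mero_entries_submodule) => _ [[->|->]|->].
- exact: mero_s1.
- exact: mero_v2.
- exact: mero_s3.
- move=> hs; apply: (gm_germ Esub (germ_sym (coords_germ s))).
  apply: (gm_add Esub); first exact: (gm_scale Esub (mero_coord1 hs) Etilde_s1).
  apply: (gm_add Esub); first exact: (gm_scale Esub (mero_coord2 hs) Etilde_v2).
  exact: (gm_scale Esub (mero_coord3 hs) Etilde_v3).
Qed.

End Stalk.

(** * The filtration in the coordinates of the frame *)

Section Filt.
Variable R : realType.
Local Notation C := (cplx R).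
Variable f : {poly C}.
Hypothesis f0 : f != 0.
Variable P : R -> set (germs R 3).
Hypothesis hgood : good_filtered_higgs (Etilde_oo f) P (theta_oo f).
Hypothesis hsym : symmetric_pairing (Etilde_oo f) P (theta_oo f) (@gramC R).
Hypothesis hperf : perfect_pairing (Etilde_oo f) P (@gramC R).
Implicit Types (s t : germs R 3).
Local Notation tau := (tau_oo f).
Local Notation s1 := (s1 f).
Local Notation v2 := (v2 f).
Local Notation v3 := (v3 f).
Local Notation N := (infty_order f).
Local Notation pair := (pairing (@gramC R)).

Let fb : filtered_bundle (Etilde_oo f) P := hgood.1.1.

Let pl c s : Etilde_oo f s -> P c s <->
    (forall a t, P a t -> germO (Num.floor (a + c)) (pair s t)) :=
  @perfect_lattice R 3 (@gram R) _ _ _ hsym hperf c s.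

Lemma lattice_entries c s : P c s -> mero_entries s.
Proof. by move=> Ps; apply/(Etilde_ooP f0)/(lattice_sub fb Ps). Qed.

Definition gcoord1 s w := coord1 (tau w) (s w).
Definition gcoord2 s w := coord2 (tau w) (s w).
Definition gcoord3 s w := coord3 (tau w) (s w).

Lemma infty_order_ge2 : 2 <= N.
Proof. by rewrite /infty_order; move: f0; rewrite -size_poly_gt0; lia. Qed.

Lemma mero_dirr (p : {poly C}) : mero (dirr p).
Proof.
apply: mero_mul (mero_opp (mero_expz R (- 2))) (mero_horner_inv _).
Qed.

Lemma pole_pullback_tau (m : nat) : (0 < m)%N ->
  pole (m%:Z * N - m.-1%:Z) (fun z => m%:R * z ^+ m.-1 * tau (z ^+ m)).
Proof.
move=> m0; have mC : (m%:R : C) != 0 by rewrite pnatr_eq0 -lt0n.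
have := pole_mul (pole_mul (pole_cst mC) (pole_expz R m.-1)) (pole_powm m0 (pole_tau f0)).
by rewrite add0r addrC.
Qed.

Lemma theta_pullback (m : nat) (l : C) z :
  let K := m%:R * z ^+ m.-1 in
  pullback_higgs m (theta_oo f) z - (l * (K * tau (z ^+ m)))%:M =
  K *: (theta_at (tau (z ^+ m)) - (l * tau (z ^+ m))%:M).
Proof.
move=> K; rewrite /pullback_higgs /theta_oo theta_atE scalerBr scale_scalar_mx.
by rewrite (mulrCA l).
Qed.

(** The projection onto E1 as a rational expression in the pulled-back Higgs
    field; the factor m z^(m-1) comes from dw = m z^(m-1) dz and cancels. *)
Lemma gcoord1_pullback (m : nat) s z : (0 < m)%N -> z != 0 -> tau (z ^+ m) != 0 ->
  let A := pullback_higgs m (theta_oo f) z - (- 1 * (m%:R * z ^+ m.-1 * tau (z ^+ m)))%:M in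
  ((2 - - 1) * (m%:R * z ^+ m.-1 * tau (z ^+ m))) ^- 2 *: (A *m (A *m s (z ^+ m)))
  = gcoord1 s (z ^+ m) *: s1 (z ^+ m).
Proof.
move=> m0 z0 t0 A; rewrite /A theta_pullback mulN1r.
rewrite -!scalemxAl -!scalemxAr theta_ker3// s1E !scalerA; congr (_ *: _).
have mC : (m%:R : C) != 0 by rewrite pnatr_eq0 -lt0n.
have zC : z ^+ m.-1 != 0 by rewrite expf_neq0.
rewrite /gcoord1; move: t0 zC; move: (coord1 _ _) => c; move: (tau _) (z ^+ m.-1) => t y t0 y0.
rewrite (_ : 2 - -1 = 3%:R); last by ring.
by field; rewrite t0 y0 mC.
Qed.

(** Where goodness enters: the projection preserves each summand of the
    pulled-back lattice, and perfectness brings the result back to P_c. *)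
Lemma gcoord1_lattice c s : P c s -> P c (fun w => gcoord1 s w *: s1 w).
Proof.
move=> Ps; have me := lattice_entries Ps.
have [m m0 [k [aa [Ea [Pa [_ _ fh [_ dP] logh]]]]]] := hgood.2.
apply: (pullback_filt_descent fb hsym hperf m0).
  by apply/(Etilde_ooP f0); exact: (gm_scale (mero_entries_submodule R) (mero_coord1 f0 me)
      (mero_s1 f0)).
have [dPc _] := dP (m%:R * c).
have /dPc[t [Pt st]] : pullback_filt m P (m%:R * c) (fun z => s (z ^+ m)).
  apply: span_incl (holo_ring R) _; exists c, 0; split; first by rewrite addr0.
  have hs := span_submodule [set (fun z => s (z ^+ m)) | s in P c] (holo_ring R).
  apply: (gm_germ hs (germ_eqW _)); last by apply: span_incl (holo_ring R) _; exists s.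
  by move=> z _; rewrite expr0z scale1r.
apply/dPc.
pose H z := m%:R * z ^+ m.-1 * tau (z ^+ m).
pose A z := pullback_higgs m (theta_oo f) z - (- 1 * H z)%:M.
exists (fun i z => ((2 - - 1) * H z) ^- 2 *: (A z *m (A z *m t i z))); split.
  move=> i; apply: (projector_lattice (delta := dirr (aa i)) (m := m%:Z * N - m.-1%:Z)) => //.
  - exact: fb_lattice (fh i).1 _.
  - by have := infty_order_ge2; nia.
  - exact: pole_pullback_tau.
  - exact: mero_dirr.
  - by rewrite -subr_eq0 (_ : 2 - -1 = 3%:R :> C) ?pnatr_eq0//; ring.
  - by move=> x; exact: logh.
  - move=> z; rewrite !theta_pullback -!scalemxAl -!scalemxAr.
    by rewrite mulN1r theta_cayley !scaler0.
apply: filterS3 (near_neq0 R) (near_powm m0 (tau_near0 f0)) st => z z0 t0 st.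
rewrite -gcoord1_pullback// st !mulmx_sumr scaler_sumr//.
Qed.

Lemma pair_s1 s : pair s s1 =~ (fun w => gcoord1 s w * (9 * tau w ^+ 2)).
Proof.
apply: filterS (tau_near0 f0) => w t0; rewrite /gcoord1 coord1E// divfK//.
by rewrite mulf_neq0 ?expf_neq0// pnatr_eq0.
Qed.

Lemma pole_s1s1 : pole (N + N) (fun w => 9 * tau w ^+ 2).
Proof.
have h9 : (9 : C) != 0 by rewrite pnatr_eq0.
have := pole_mul (pole_cst h9) (pole_mul (pole_tau f0) (pole_tau f0)).
by rewrite add0r; apply: pole_germ; apply: germ_eqW => w _; rewrite expr2.
Qed.

Lemma pairC s t : pair s t = pair t s.
Proof. by apply/funext => w; exact: dotC. Qed.

Lemma gcoord1_s1 : gcoord1 s1 =~ (fun=> 1).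
Proof.
apply: filterS (tau_near0 f0) => w t0; rewrite /gcoord1 /coord1 s1E dot11 mulfV//.
by rewrite mulf_neq0 ?expf_neq0// pnatr_eq0.
Qed.

(** C(s1, s1) has a pole of order 2N, and s1 is orthogonal to E3; thus the
    filtration of E1 is its own dual only if s1 has degree N. *)
Lemma lattice_s1 c : P c s1 <-> N%:~R <= c.
Proof.
have ge a : P a s1 -> N%:~R <= a.
  move=> Pa; have := sp_filt hsym (lexx _) Pa Pa.
  move/(germO_germ (germ_trans (pair_s1 s1) _)) => /(_ (fun w => 9 * tau w ^+ 2)).
  have e : (fun w => gcoord1 s1 w * (9 * tau w ^+ 2)) =~ (fun w => 9 * tau w ^+ 2).
    by apply: filterS gcoord1_s1 => w ->; rewrite mul1r.
  move=> /(_ e)/(pole_germO _ pole_s1s1); rewrite floor_ge_int intrD; lra.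
split=> [/ge//|Nc]; apply: (fb_mono fb Nc).
apply/(pl _ (Etilde_s1 f)) => a t Pt; rewrite pairC.
apply: germO_germ (germ_sym (pair_s1 t)) _.
have [z|[k pk]] := pole_ex (mero_coord1 f0 (lattice_entries Pt)).
  by apply: germO_zero; apply: filterS z => w h; rewrite /gcoord1 h mul0r.
have := (lattice_pole fb a s1 pk).1 (gcoord1_lattice Pt) => /ge h.
apply/(pole_germO _ (pole_mul pk pole_s1s1)); rewrite floor_ge_int !intrD.
by lra.
Qed.

Lemma pole_K : pole N (fun w => - (3 * tau w)).
Proof.
have h3 : (- 3 : C) != 0 by rewrite oppr_eq0 pnatr_eq0.
have := pole_mul (pole_cst h3) (pole_tau f0); rewrite add0r.
by apply: pole_germ; apply: germ_eqW => w _; rewrite mulNr.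
Qed.

Definition E3_component s w := gcoord2 s w *: v2 w + gcoord3 s w *: v3 w.

Lemma E3_component_germ s : (fun w => s w + (- 1 : C) *: (gcoord1 s w *: s1 w)) =~ E3_component s.
Proof.
apply: filterS (coords_germ f0 s) => w h; rewrite {1}h scaleN1r addrC addKr //.
Qed.

Lemma E3_component_lattice c s : P c s -> P c (E3_component s).
Proof.
move=> Ps; have mP := lattice_submodule fb c.
apply: (gm_germ mP (E3_component_germ s)); apply: (gm_add mP) => //.
exact: (gm_scale mP (holo_cst (-1)) (gcoord1_lattice Ps)).
Qed.

Lemma pair_E3_component s t (g2 g3 : C -> C) :
  pair (fun w => g2 w *: v2 w + g3 w *: v3 w) t =~
  (fun w => (g2 w * gcoord3 t w + g3 w * gcoord2 t w) * - (3 * tau w)).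
Proof.
apply: filterS (tau_near0 f0) => w t0; rewrite /pairing -/(dot _ _) dotDl !dotZl.
rewrite /gcoord2 /gcoord3 /coord2 /coord3 -v3E// -v2E// (dotC (t w)) (dotC (t w)).
move: t0; move: (dot (v2 w) _) (dot (v3 w) _) (tau w) (g2 w) (g3 w) => x y u a b u0.
by field.
Qed.

(** An isotropic line of a self-dual filtered plane splits off, together with the
    other isotropic line. *)
Lemma gcoord2_lattice c s : P c s -> P c (fun w => gcoord2 s w *: v2 w).
Proof.
move=> Ps; apply: contrapT => nP; have me := lattice_entries Ps.
have Prs := E3_component_lattice Ps.
have Ey : Etilde_oo f (fun w => gcoord2 s w *: v2 w).
  apply/(Etilde_ooP f0).
  exact: (gm_scale (mero_entries_submodule R) (mero_coord2 f0 me) (mero_v2 f0)).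
have [a [t [Pt ng]]] : exists a t, P a t /\
    ~ germO (Num.floor (a + c)) (pair (fun w => gcoord2 s w *: v2 w) t).
  apply: contrapT => h; apply: nP; apply/(pl _ Ey) => a t Pt.
  by apply: contrapT => ng; apply: h; exists a, t.
have mt := lattice_entries Pt; have Prt := E3_component_lattice Pt.
have m2 := mero_coord2 f0 me; have m3 := mero_coord3 f0 me.
have n2 := mero_coord2 f0 mt; have n3 := mero_coord3 f0 mt.
have mK := pole_mero pole_K.
have e2 : pair (fun w => gcoord2 s w *: v2 w) t =~ (fun w =>
    (gcoord2 s w * gcoord3 t w) * - (3 * tau w)).
  apply: germ_trans (germ_trans _ (pair_E3_component t t (gcoord2 s) (fun=> 0))) _.
    by apply: pairing_germ (germ_refl _); apply: germ_eqW => w _; rewrite scale0r addr0.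
  by apply: germ_eqW => w _; rewrite mul0r addr0.
have g1 : ~ germO (Num.floor (a + c)) (fun w => (gcoord2 s w * gcoord3 t w) * - (3 * tau w)).
  by move=> h; apply: ng; exact: germO_germ (germ_sym e2) h.
have g2 : ~ germO (Num.floor (a + c)) (fun w => (gcoord3 s w * gcoord2 t w) * - (3 * tau w)).
  move=> h; apply: g1; have hx := sp_filt hsym (lexx _) Prs Pt; rewrite addrC in hx.
  have hn : germO (Num.floor (a + c)) (fun w =>
      (-1 : C) * (gcoord3 s w * gcoord2 t w * - (3 * tau w))).
    by rewrite -[Num.floor _]add0r; exact: germO_mul (holo_cst _ : germO 0 _) h.
  apply: germO_germ (germO_add hx hn); apply: filterS (pair_E3_component t t (gcoord2 s) (gcoord3
      s)) => w ->.
  by move: (gcoord2 s w) (gcoord3 t w) (gcoord3 s w) (gcoord2 t w) (3 * tau w) => *; ring.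
have [k kp kn] := mero_not_germO (mero_mul (mero_mul m2 n3) mK) g1.
have [k' kp' kn'] := mero_not_germO (mero_mul (mero_mul m3 n2) mK) g2.
have [j [N1 [/(mul_pole_factors m2 n3)[p2 [q3 [pp2 pq3 ej]]] pN1 ek]]] :=
    mul_pole_factors (mero_mul m2 n3) mK kp.
have [j' [N2 [/(mul_pole_factors m3 n2)[p3 [q2 [pp3 pq2 ej']]] pN2 ek']]] :=
    mul_pole_factors (mero_mul m3 n2) mK kp'.
have [e1' e2'] := (pole_uniq pN1 pole_K, pole_uniq pN2 pole_K); subst.
have self u : pair (E3_component u) (E3_component u) =~ (fun w =>
    2 * (gcoord2 u w * gcoord3 u w) * - (3 * tau w)).
  apply: germ_trans (pair_E3_component u (E3_component u) (gcoord2 u) (gcoord3 u)) _.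
  apply: filterS (tau_near0 f0) => w t0; rewrite /gcoord2 /gcoord3 /E3_component v2E v3E//
      -/(gcoord2 u w) -/(gcoord3 u w).
  have [] := coords_uniq 0 (gcoord2 u w) (gcoord3 u w) t0; rewrite scale0r add0r => _ -> ->.
  by move: (gcoord2 u w) (gcoord3 u w) (3 * tau w) => *; ring.
have h2 : (2 : C) != 0 by rewrite pnatr_eq0.
have hs : germO (Num.floor (c + c)) (fun w => 2 * (gcoord2 s w * gcoord3 s w) * - (3 * tau w)).
  exact: germO_germ (self s) (sp_filt hsym (lexx _) Prs Prs).
have ht : germO (Num.floor (a + a)) (fun w => 2 * (gcoord2 t w * gcoord3 t w) * - (3 * tau w)).
  exact: germO_germ (self t) (sp_filt hsym (lexx _) Prt Prt).
move: hs => /(pole_germO _ (pole_mul (pole_mul (pole_cst h2) (pole_mul pp2 pp3)) pole_K)).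
move: ht => /(pole_germO _ (pole_mul (pole_mul (pole_cst h2) (pole_mul pq2 pq3)) pole_K)).
move: kn kn'; rewrite !floor_ge_int !ltNge !floor_ge_int -!ltNge !intrD.
by lra.
Qed.

Lemma gcoord3_lattice c s : P c s -> P c (fun w => gcoord3 s w *: v3 w).
Proof.
move=> Ps; have mP := lattice_submodule fb c.
apply: (gm_germ mP _ (gm_add mP (E3_component_lattice Ps) (gm_scale mP (holo_cst (-1))
    (gcoord2_lattice Ps)))).
by apply: germ_eqW => w _; rewrite /E3_component scaleN1r addrC addKr.
Qed.

Lemma pair_v2v3 : pair v2 v3 =~ (fun w => - (3 * tau w)).
Proof. by apply: filterS (tau_near0 f0) => w t0; rewrite /pairing -/(dot _ _) v2E v3E// dot23. Qed.

(** This bounds the degrees of v2 and v3 from below, so that they are attained. *)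
Lemma lattice_v2v3 a c : P a v2 -> P c v3 -> N%:~R <= a + c.
Proof.
move=> P2 P3; have := germO_germ pair_v2v3 (sp_filt hsym (lexx _) P2 P3).
by move=> /(pole_germO _ pole_K); rewrite floor_ge_int.
Qed.

Lemma lattice_v2 c : P c v2 <-> deg P v2 <= c.
Proof.
apply: (deg_lattice fb (Etilde_v2 f)); have [a Pa] := lattice_ex fb (Etilde_v3 f0).
by exists (N%:~R - a - 1) => h; have := lattice_v2v3 h Pa; lra.
Qed.

Lemma lattice_v3 c : P c v3 <-> deg P v3 <= c.
Proof.
apply: (deg_lattice fb (Etilde_v3 f0)); have [a Pa] := lattice_ex fb (Etilde_v2 f).
by exists (N%:~R - a - 1) => h; have := lattice_v2v3 Pa h; lra.
Qed.

Lemma lattice_coords c s : mero_entries s -> P c s <->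
  [/\ germO (Num.floor (c - N%:~R)) (gcoord1 s), germO (Num.floor (c - deg P v2)) (gcoord2 s) &
      germO (Num.floor (c - deg P v3)) (gcoord3 s)].
Proof.
move=> me; have mP := lattice_submodule fb c.
have L1 := lattice_line fb lattice_s1 c (mero_coord1 f0 me).
have L2 := lattice_line fb lattice_v2 c (mero_coord2 f0 me).
have L3 := lattice_line fb lattice_v3 c (mero_coord3 f0 me).
split=> [Ps|[/L1 h1 /L2 h2 /L3 h3]].
  by split; [apply/L1; exact: gcoord1_lattice|apply/L2; exact: gcoord2_lattice|apply/L3;
      exact: gcoord3_lattice].
apply: (gm_germ mP (germ_sym (coords_germ f0 s))).
exact: (gm_add mP h1 (gm_add mP h2 h3)).
Qed.

Lemma coords_mero_entries s : mero (gcoord1 s) -> mero (gcoord2 s) -> mero (gcoord3 s) ->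
    mero_entries s.
Proof.
move=> h1 h2 h3; have mM := mero_entries_submodule R.
apply: (gm_germ mM (germ_sym (coords_germ f0 s))).
apply: (gm_add mM (gm_scale mM h1 (mero_s1 f0)) _).
exact: (gm_add mM (gm_scale mM h2 (mero_v2 f0)) (gm_scale mM h3 (mero_v3 f0))).
Qed.

Lemma Etilde_coords s : Etilde_oo f s <-> [/\ mero (gcoord1 s),
    mero (gcoord2 s) & mero (gcoord3 s)].
Proof.
split=> [/(Etilde_ooP f0) me|[h1 h2 h3]].
  by split; [exact: mero_coord1|exact: mero_coord2|exact: mero_coord3].
exact/(Etilde_ooP f0)/coords_mero_entries.
Qed.

Lemma lattice_coordsP c s : P c s <->
  [/\ germO (Num.floor (c - (size f).-1%:R - 2)) (gcoord1 s),
      germO (Num.floor (c - deg P v2)) (gcoord2 s) &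
      germO (Num.floor (c - deg P v3)) (gcoord3 s)].
Proof.
have e : c - (size f).-1%:R - 2 = c - N%:~R.
  rewrite /infty_order; have := f0; rewrite -size_poly_gt0 => /prednK <-.
  rewrite intrD -natr1 /=; ring.
rewrite e; split=> [Ps|h].
  exact/(lattice_coords _ (lattice_entries Ps)).
apply/lattice_coords => //; case: h => h1 h2 h3.
by apply: coords_mero_entries; [exact: germO_mero h1|exact: germO_mero h2|exact: germO_mero h3].
Qed.

End Filt.

(** * From the stalk at infinity to the sheaves *)

Section Sheaf.
Variable R : realType.
Local Notation C := (cplx R).
Variable f : {poly C}.
Implicit Types (s a b : germs R 3) (V : set (P1 R)) (O : set (C -> C)).
Local Notation tau := (tau_oo f).
Local Notation gc1 := (gcoord1 f).
Local Notation gc2 := (gcoord2 f).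
Local Notation gc3 := (gcoord3 f).
Opaque pow2 cbrt2.

Definition good_nbhd : set (P1 R) :=
  [set x | if x is Some z then z != 0 /\ f.[z] != 0 else True].
Local Notation U := good_nbhd.

(** The analogue of tau_oo in the chart z. *)
Definition tau_0 (z : C) : C := f.[z] / cbrt2 R.

Lemma tau_inv z : tau z^-1 = - z ^+ 2 * tau_0 z.
Proof. by rewrite /tau /foo /tau_0 invrK exprVn invrK mulrA. Qed.

Lemma tau_0_neq0 z : U (Some z) -> tau_0 z != 0.
Proof. by move=> [_ fz]; rewrite /tau_0 mulf_neq0// invr_eq0 cbrt2_neq0. Qed.

Lemma tau_inv_neq0 z : U (Some z) -> tau z^-1 != 0.
Proof.
move=> Uz; have [z0 _] := Uz.
by rewrite tau_inv mulf_neq0 ?oppr_eq0 ?expf_neq0 ?tau_0_neq0.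
Qed.

Lemma good_nbhd_near z : U (Some z) -> \forall x \near z, U (Some x).
Proof.
move=> [z0 fz]; have h1 := analytic_near_neq0 (analytic_id z) z0.
exact: filterS2 h1 (analytic_near_neq0 (analytic_horner z f) fz).
Qed.

Lemma open_good_nbhd : f != 0 -> P1_open U.
Proof.
move=> f0; split; rewrite openE => w /=; rewrite /interior.
  exact: good_nbhd_near.
rewrite /chartoo; case: eqVneq => [->|w0] Uw.
  have h0 : \forall x \near (0 : C), x != 0 -> tau x != 0 := tau_near0 f0.
  apply: filterS h0 => x h /=; case: eqVneq => [//|x0]; have := h x0.
  rewrite /tau_oo /foo mulf_eq0 negb_or mulf_eq0 negb_or => /andP[/andP[_ fx] _].
  by split=> //; rewrite invr_eq0.
have := inv_continuous w0 (good_nbhd_near Uw).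
have := analytic_near_neq0 (analytic_id w) w0; apply: filterS2 => x x0 Ux /=.
by rewrite /chartoo (negPf x0).
Qed.

Lemma open_near V z : P1_open V -> V (Some z) -> \forall x \near z, V (Some x).
Proof. by move=> [V0 _]; move: V0; rewrite openE; apply. Qed.

Lemma open_near_oo V : P1_open V -> V None -> \forall w \near (0 : C)^', V (Some w^-1).
Proof.
move=> [_ Vo] VN; have : (chartoo (R:=R) @^-1` V) 0 by rewrite /= /chartoo eqxx.
move: Vo; rewrite openE => /[apply]; apply: filterS => w h w0.
by move: h; rewrite /= /chartoo (negPf w0).
Qed.

Definition frame1 := change_chart (s1 f).
Definition frame2 := change_chart (v2 f).
Definition frame3 := change_chart (v3 f).

Lemma frame_col3 w (x y z : C) :
  frame_mx w *m col3 x y z = col3 (- w ^- 2 * x) y (- w ^+ 2 * z).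
Proof.
rewrite mul_diag_mx; apply/matrixP => i j; rewrite !mxE.
by case: i => [[|[|[|]]]] //= _; rewrite ?mul1r.
Qed.

Lemma frame1E z : z != 0 -> frame1 z = - z ^+ 2 *: s1_at (tau_0 z).
Proof.
move=> z0; rewrite /frame1 /change_chart s1E tau_inv frame_col3 scale_col3.
by move: (tau_0 z) => t; congr col3; field.
Qed.

Lemma frame2E z : z != 0 -> frame2 z = - z ^+ 2 *: v2_at (tau_0 z).
Proof.
move=> z0; rewrite /frame2 /change_chart v2E tau_inv frame_col3 scale_col3.
by move: (tau_0 z) => t; congr col3; field.
Qed.

Lemma frame3E z : U (Some z) -> frame3 z = v3_at (tau_0 z).
Proof.
move=> Uz; have [z0 _] := Uz; have t0 := tau_0_neq0 Uz.
rewrite /frame3 /change_chart v3E ?tau_inv_neq0// tau_inv /v3_at.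
rewrite scale_col3 add_col3 frame_col3 scale_col3 add_col3.
by move: t0; move: (tau_0 z) => t t0; congr col3; field; rewrite ?t0 ?z0.
Qed.

Definition scoord1 s z := gc1 (change_chart s) z^-1.
Definition scoord2 s z := gc2 (change_chart s) z^-1.
Definition scoord3 s z := gc3 (change_chart s) z^-1.

Lemma section_coords s z : U (Some z) ->
  s z = scoord1 s z *: frame1 z + (scoord2 s z *: frame2 z + scoord3 s z *: frame3 z).
Proof.
move=> Uz; have [z0 _] := Uz; have t0 := tau_inv_neq0 Uz.
rewrite -[LHS](change_chartK s z0) {1}/change_chart.
rewrite [change_chart s z^-1](coords _ t0) !mulmxDr -!scalemxAr.
by rewrite -(s1E f) -(v2E f) -(v3E t0).
Qed.

Lemma section_coords_uniq s z x y t : U (Some z) ->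
  s z = x *: frame1 z + (y *: frame2 z + t *: frame3 z) ->
  [/\ scoord1 s z = x, scoord2 s z = y & scoord3 s z = t].
Proof.
move=> Uz e; have [z0 _] := Uz; have t0 := tau_inv_neq0 Uz.
have zV0 : z^-1 != 0 by rewrite invr_eq0.
have E a : frame_mx z^-1 *m change_chart a z = a z^-1.
  by have := change_chartK a zV0; rewrite {1}/change_chart invrK.
have E1 : frame_mx z^-1 *m frame1 z = s1_at (tau z^-1) by rewrite (E (s1 f)) (s1E f).
have E2 : frame_mx z^-1 *m frame2 z = v2_at (tau z^-1) by rewrite (E (v2 f)) (v2E f).
have E3 : frame_mx z^-1 *m frame3 z = v3_at (tau z^-1) by rewrite (E (v3 f)) (v3E t0).
have h : change_chart s z^-1 =
    x *: s1_at (tau z^-1) + (y *: v2_at (tau z^-1) + t *: v3_at (tau z^-1)).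
  have L (A : 'M[C]_3) (u v w : 'cV[C]_3) :
      A *m (x *: u + (y *: v + t *: w)) = x *: (A *m u) + (y *: (A *m v) + t *: (A *m w)).
    by rewrite !mulmxDr -!scalemxAr.
  by rewrite /change_chart invrK e L E1 E2 E3.
rewrite /scoord1 /scoord2 /scoord3 /gcoord1 /gcoord2 /gcoord3 h; exact: coords_uniq.
Qed.

Definition analytic_entries z s := forall i, analytic_at z (fun x => s x i 0).

Lemma analytic_opp z (g : C -> C) : analytic_at z g -> analytic_at z (fun x => - g x).
Proof.
move=> ag; rewrite (_ : (fun x => - g x) = (fun x => -1 * g x)).
  exact: analytic_mul (analytic_cst _ _) ag.
by apply/funext => x; rewrite mulN1r.
Qed.

Lemma entries_col3 z (x y t : C -> C) :
  analytic_at z x -> analytic_at z y -> analytic_at z t ->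
  analytic_entries z (fun w => col3 (x w) (y w) (t w)).
Proof.
move=> hx hy ht [[|[|[|i]]]] hi; last by clear -hi.
- by rewrite (_ : (fun w => _) = x)//; apply/funext => w; rewrite mxE.
- by rewrite (_ : (fun w => _) = y)//; apply/funext => w; rewrite mxE.
- by rewrite (_ : (fun w => _) = t)//; apply/funext => w; rewrite mxE.
Qed.

Lemma entries_near z s a : (\forall x \near z, s x = a x) ->
  analytic_entries z s -> analytic_entries z a.
Proof. by move=> e h i; apply: analytic_near_eq (h i); apply: filterS e => x ->. Qed.

Lemma entries_add z s a : analytic_entries z s -> analytic_entries z a ->
  analytic_entries z (fun x => s x + a x).
Proof.
move=> hs ha i; rewrite (_ : (fun w => _) = (fun w => s w i 0 + a w i 0)).
  exact: (analytic_add (hs i) (ha i)).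
by apply/funext => w; rewrite mxE.
Qed.

Lemma entries_scale z (g : C -> C) s : analytic_at z g -> analytic_entries z s ->
  analytic_entries z (fun x => g x *: s x).
Proof.
move=> hg hs i; rewrite (_ : (fun w => _) = (fun w => g w * s w i 0)).
  exact: (analytic_mul hg (hs i)).
by apply/funext => w; rewrite mxE.
Qed.

Lemma analytic_dot z s a : analytic_entries z s -> analytic_entries z a ->
  analytic_at z (fun x => dot (s x) (a x)).
Proof.
move=> hs ha.
have h := analytic_add (analytic_add (analytic_mul (hs 0) (ha 2))
  (analytic_mul (hs 1) (ha 1))) (analytic_mul (hs 2) (ha 0)).
rewrite (_ : (fun w => _) = (fun w =>
  s w 0 0 * a w 2 0 + s w 1 0 * a w 1 0 + s w 2 0 * a w 0 0))//.
by apply/funext => w; rewrite {1}(col3E (s w)) {1}(col3E (a w)) dot_col3.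
Qed.

Lemma analytic_tau_0 z : analytic_at z tau_0.
Proof. exact: analytic_mul (analytic_horner _ _) (analytic_cst _ _). Qed.

Lemma analytic_msqr z : analytic_at z (fun x : C => - x ^+ 2).
Proof. exact/analytic_opp/analytic_pow/analytic_id. Qed.

Lemma analytic_tau z : analytic_at z (fun x => tau x^-1).
Proof.
rewrite (_ : (fun x => _) = (fun x => - x ^+ 2 * tau_0 x)).
  exact: (analytic_mul (analytic_msqr z) (analytic_tau_0 z)).
by apply/funext => x; rewrite tau_inv.
Qed.

Lemma entries_v2_at z : analytic_entries z (fun x => v2_at (tau_0 x)).
Proof.
have ht := analytic_tau_0 z; apply: entries_col3.
- exact: (analytic_opp (analytic_mul (analytic_pow 2 ht) (analytic_cst _ _))).
- exact: (analytic_opp ht).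
- exact: analytic_cst.
Qed.

Lemma entries_frame1 z : U (Some z) -> analytic_entries z frame1.
Proof.
move=> Uz; have ht := analytic_tau_0 z.
apply: (@entries_near _ (fun x => - x ^+ 2 *: s1_at (tau_0 x))).
  by apply: filterS (good_nbhd_near Uz) => x [x0 _]; rewrite frame1E.
apply: (entries_scale (analytic_msqr z)); apply: entries_col3.
- exact: (analytic_mul (analytic_cst _ _) (analytic_pow 2 ht)).
- exact: (analytic_mul (analytic_cst _ _) ht).
- exact: analytic_cst.
Qed.

Lemma entries_frame2 z : U (Some z) -> analytic_entries z frame2.
Proof.
move=> Uz; apply: (@entries_near _ (fun x => - x ^+ 2 *: v2_at (tau_0 x))).
  by apply: filterS (good_nbhd_near Uz) => x [x0 _]; rewrite frame2E.
exact: (entries_scale (analytic_msqr z) (entries_v2_at z)).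
Qed.

Lemma entries_frame3 z : U (Some z) -> analytic_entries z frame3.
Proof.
move=> Uz; have ht := analytic_tau_0 z.
apply: (@entries_near _ (fun x => s3_at (tau_0 x) + (6 * tau_0 x)^-1 *: v2_at (tau_0 x))).
  by apply: filterS (good_nbhd_near Uz) => x Ux; rewrite frame3E.
have h : analytic_at z (fun x => (6 * tau_0 x)^-1).
  apply: analytic_inv; first exact: (analytic_mul (analytic_cst _ _) ht).
  by rewrite mulf_neq0 ?pnatr_eq0// tau_0_neq0.
apply: entries_add (entries_scale h (entries_v2_at z)); apply: entries_col3.
- exact: (analytic_opp (analytic_mul (analytic_cst _ _) ht)).
- exact: analytic_cst.
- exact: analytic_cst.
Qed.

Lemma dot_chart s a z : z != 0 ->
  dot (change_chart s z^-1) (a z^-1) = dot (s z) (change_chart a z).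
Proof.
move=> z0; have := pairing_change_chart (change_chart s) a z0.
by rewrite /pairing change_chartK// => ->.
Qed.

Lemma scoord1E s z : z != 0 -> scoord1 s z = dot (s z) (frame1 z) / (9 * tau z^-1 ^+ 2).
Proof. by move=> z0; rewrite /scoord1 /gcoord1 /coord1 -(s1E f) dot_chart. Qed.

Lemma scoord2E s z : U (Some z) -> scoord2 s z = - (dot (s z) (frame3 z) / (3 * tau z^-1)).
Proof.
move=> Uz; have [z0 _] := Uz.
by rewrite /scoord2 /gcoord2 /coord2 -(v3E (tau_inv_neq0 Uz)) dot_chart.
Qed.

Lemma scoord3E s z : z != 0 -> scoord3 s z = - (dot (s z) (frame2 z) / (3 * tau z^-1)).
Proof. by move=> z0; rewrite /scoord3 /gcoord3 /coord3 -(v2E f) dot_chart. Qed.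

Lemma analytic_scoord1 s z : U (Some z) -> analytic_entries z s -> analytic_at z (scoord1 s).
Proof.
move=> Uz hs.
apply: (@analytic_near_eq _ _ (fun x => dot (s x) (frame1 x) * (9 * tau x^-1 ^+ 2)^-1)).
  by apply: filterS (good_nbhd_near Uz) => x [x0 _]; rewrite scoord1E.
have h : analytic_at z (fun x => (9 * tau x^-1 ^+ 2)^-1).
  apply: analytic_inv.
    exact: (analytic_mul (analytic_cst _ _) (analytic_pow 2 (analytic_tau z))).
  by rewrite mulf_neq0 ?expf_neq0 ?tau_inv_neq0 ?pnatr_eq0.
exact: (analytic_mul (analytic_dot hs (entries_frame1 Uz)) h).
Qed.

Lemma analytic_inv_3tau z : U (Some z) -> analytic_at z (fun x => (3 * tau x^-1)^-1).
Proof.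
move=> Uz; apply: analytic_inv.
  exact: (analytic_mul (analytic_cst _ _) (analytic_tau z)).
by rewrite mulf_neq0 ?tau_inv_neq0 ?pnatr_eq0.
Qed.

Lemma analytic_scoord2 s z : U (Some z) -> analytic_entries z s -> analytic_at z (scoord2 s).
Proof.
move=> Uz hs.
apply: (@analytic_near_eq _ _ (fun x => - (dot (s x) (frame3 x) * (3 * tau x^-1)^-1))).
  by apply: filterS (good_nbhd_near Uz) => x Ux; rewrite scoord2E.
exact: (analytic_opp (analytic_mul (analytic_dot hs (entries_frame3 Uz)) (analytic_inv_3tau Uz))).
Qed.

Lemma analytic_scoord3 s z : U (Some z) -> analytic_entries z s -> analytic_at z (scoord3 s).
Proof.
move=> Uz hs.
apply: (@analytic_near_eq _ _ (fun x => - (dot (s x) (frame2 x) * (3 * tau x^-1)^-1))).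
  by apply: filterS (good_nbhd_near Uz) => x [x0 _]; rewrite scoord3E.
exact: (analytic_opp (analytic_mul (analytic_dot hs (entries_frame2 Uz)) (analytic_inv_3tau Uz))).
Qed.

Lemma scoord1_inv s : (fun w => scoord1 s w^-1) = gc1 (change_chart s).
Proof. by apply/funext => w; rewrite /scoord1 invrK. Qed.

Lemma scoord2_inv s : (fun w => scoord2 s w^-1) = gc2 (change_chart s).
Proof. by apply/funext => w; rewrite /scoord2 invrK. Qed.

Lemma scoord3_inv s : (fun w => scoord3 s w^-1) = gc3 (change_chart s).
Proof. by apply/funext => w; rewrite /scoord3 invrK. Qed.

Lemma theta_tau_0 z : theta f.[z] = theta_at (tau_0 z).
Proof. exact: theta_atE. Qed.

Lemma eigenvalue1_tau_0 z : pow2 (2 / 3) * f.[z] = 2 * tau_0 z.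
Proof. exact: pow2_23. Qed.

Lemma eigenvalue2_tau_0 z : - pow2 (- (1 / 3)) * f.[z] = - tau_0 z.
Proof. by rewrite mulNr pow2_N13. Qed.

Opaque tau_0 scoord1 scoord2 scoord3 frame1 frame2 frame3 s1_at v2_at v3_at.

Lemma frame_indep t (x y u : C) : t != 0 -> x *: s1_at t + (y *: v2_at t + u *: v3_at t) = 0 ->
  [/\ x = 0, y = 0 & u = 0].
Proof.
move=> t0 e; have [] := coords_uniq x y u t0; rewrite e.
have d0 v : dot 0 v = 0 by rewrite -(scale0r 0) dotZl mul0r.
by rewrite /coord1 /coord2 /coord3 !d0 !mul0r oppr0.
Qed.

Lemma local_coords s z : U (Some z) ->
  [/\ coord1 (tau_0 z) (s z) = - z ^+ 2 * scoord1 s z,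
      coord2 (tau_0 z) (s z) = - z ^+ 2 * scoord2 s z
    & coord3 (tau_0 z) (s z) = scoord3 s z].
Proof.
move=> Uz; have [z0 _] := Uz.
have -> : s z = (- z ^+ 2 * scoord1 s z) *: s1_at (tau_0 z) +
    ((- z ^+ 2 * scoord2 s z) *: v2_at (tau_0 z) + scoord3 s z *: v3_at (tau_0 z)).
  have E (x y : C) (v : 'cV[C]_3) : x *: (y *: v) = (y * x) *: v.
    by rewrite scalerA mulrC.
  rewrite [LHS](section_coords _ Uz) (frame1E z0) (frame2E z0) (frame3E Uz).
  by rewrite (E _ _ (s1_at _)) (E _ _ (v2_at _)).
exact: coords_uniq (tau_0_neq0 Uz).
Qed.

Lemma ker1E s z : U (Some z) ->
  ((theta f.[z] - (pow2 (2 / 3) * f.[z])%:M) *m s z = 0) <->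
  (scoord2 s z = 0 /\ scoord3 s z = 0).
Proof.
move=> Uz; have t0 := tau_0_neq0 Uz; have [_ h2 h3] := local_coords s Uz.
have [z0 _] := Uz; have zz : - z ^+ 2 != 0 by rewrite oppr_eq0 expf_neq0.
have h30 : 3 * tau_0 z != 0 by rewrite mulf_neq0 ?pnatr_eq0.
rewrite theta_tau_0 eigenvalue1_tau_0 theta_ker1// h2 h3; split=> [e|[-> ->]]; last first.
  by rewrite !mulr0 subr0 !scale0r subr0.
have [_ y0 u0] : [/\ 0 = 0 :> C, scoord3 s z - 3 * tau_0 z * (- z ^+ 2 * scoord2 s z) = 0
    & - (3 * tau_0 z * scoord3 s z) = 0].
  by apply: (frame_indep t0); rewrite scale0r add0r [- _ *: _]scaleNr.
have q30 : scoord3 s z = 0.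
  by move/eqP: u0; rewrite oppr_eq0 mulf_eq0 (negPf h30) => /eqP.
split=> //; move/eqP: y0; rewrite q30 sub0r oppr_eq0 mulf_eq0 (negPf h30)/=.
by rewrite mulf_eq0 (negPf zz) => /eqP.
Qed.

Lemma ker3E s z : U (Some z) ->
  (let N := theta f.[z] - (- pow2 (- (1 / 3)) * f.[z])%:M in N *m N) *m s z = 0
  <-> scoord1 s z = 0.
Proof.
move=> Uz; have t0 := tau_0_neq0 Uz; have [h1 _ _] := local_coords s Uz.
have [z0 _] := Uz; have zz : - z ^+ 2 != 0 by rewrite oppr_eq0 expf_neq0.
have h90 : 9 * tau_0 z ^+ 2 != 0 by rewrite mulf_neq0 ?expf_neq0 ?pnatr_eq0.
rewrite /= theta_tau_0 eigenvalue2_tau_0 -mulmxA theta_ker3// h1; split=> [e|->]; last first.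
  by rewrite !mulr0 scale0r.
have [/eqP x0 _ _] : [/\ 9 * tau_0 z ^+ 2 * (- z ^+ 2 * scoord1 s z) = 0, 0 = 0 :> C & 0 = 0 :> C].
  by apply: (frame_indep t0); rewrite !scale0r !addr0.
by move: x0; rewrite mulf_eq0 (negPf h90)/= mulf_eq0 (negPf zz) => /eqP.
Qed.

Record germ_group O : Prop := {
  gg_zero : O (fun=> 0) ;
  gg_add : forall g h, O g -> O h -> O (fun w => g w + h w) ;
  gg_germ : forall g h, g =~ h -> O g -> O h }.

(** For O the germs with a pole of order at most n this is the sheaf O(n.oo). Taking O
    to be all meromorphic germs treats the extended bundle itself together with
    its lattices. *)
Definition sheaf_with_stalk O V (g : C -> C) :=
  (forall z, V (Some z) -> analytic_at z g) /\ (V None -> O (fun w => g w^-1)).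

Section Extension.
Variables (V : set (P1 R)).
Hypothesis oV : P1_open V.
Hypothesis VU : V `<=` U.
Local Notation sh := sheaf_with_stalk.

Lemma sheaf_with_stalk_eq O (g h : C -> C) : germ_group O ->
  (forall z, V (Some z) -> g z = h z) -> sh O V g -> sh O V h.
Proof.
move=> gO e [ag Og]; split=> [z Vz|VN].
  by apply: analytic_near_eq (ag z Vz); apply: filterS (open_near oV Vz) => x; exact: e.
by apply: (gg_germ gO _ (Og VN)); apply: filterS (open_near_oo oV VN) => w; exact: e.
Qed.

Lemma sheaf_with_stalk_add O (g h : C -> C) : germ_group O -> sh O V g -> sh O V h ->
  sh O V (fun z => g z + h z).
Proof.
move=> gO [ag Og] [ah Oh]; split=> [z Vz|VN].
  exact: (analytic_add (ag z Vz) (ah z Vz)).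
exact: (gg_add gO (Og VN) (Oh VN)).
Qed.

Lemma sheaf_with_stalk_zero O : germ_group O -> sh O V (fun=> 0).
Proof. by move=> gO; split=> [z _|_]; [exact: analytic_cst|exact: gg_zero]. Qed.

Variables (M : set (germs R 3)) (O1 O2 O3 : set (C -> C)).
Hypotheses (g1 : germ_group O1) (g2 : germ_group O2) (g3 : germ_group O3).
Hypothesis ME : forall s, M s <-> [/\ O1 (gc1 s), O2 (gc2 s) & O3 (gc3 s)].

(** Sections and triples of coordinate functions are the same, because the frame is
    analytic and invertible over U and M is diagonal in it. *)
Lemma extension_coords s : extension M V s <->
  [/\ sh O1 V (scoord1 s), sh O2 V (scoord2 s) & sh O3 V (scoord3 s)].
Proof.
rewrite /sh scoord1_inv scoord2_inv scoord3_inv; split=> [[as_ Ms]|[[a1 M1] [a2 M2] [a3 M3]]].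
  split; split=> [z Vz|/Ms/ME[]//].
  - exact: (analytic_scoord1 (VU Vz) (as_ z Vz)).
  - exact: (analytic_scoord2 (VU Vz) (as_ z Vz)).
  - exact: (analytic_scoord3 (VU Vz) (as_ z Vz)).
split=> [z Vz|VN]; last by apply/ME; split; [exact: M1|exact: M2|exact: M3].
have Uz := VU Vz.
apply: (@entries_near z (fun z => scoord1 s z *: frame1 z + (scoord2 s z *: frame2 z + scoord3 s
    z *: frame3 z))).
  by apply: filterS (good_nbhd_near Uz) => x Ux; rewrite -section_coords.
apply: entries_add (entries_scale (a1 z Vz) (entries_frame1 Uz)) _.
exact: (entries_add (entries_scale (a2 z Vz) (entries_frame2 Uz))
                    (entries_scale (a3 z Vz) (entries_frame3 Uz))).
Qed.

Lemma extension_ker1 s :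
  (extension M V s /\ forall z, V (Some z) -> scoord2 s z = 0 /\ scoord3 s z = 0) <->
  exists g, sh O1 V g /\ eq_on V s (fun z => g z *: frame1 z).
Proof.
split=> [[/extension_coords[h1 _ _] h]|[g [hg e]]].
  exists (scoord1 s); split=> // z Vz; have [h2 h3] := h z Vz.
  by rewrite {1}(section_coords s (VU Vz)) h2 h3 !scale0r !addr0.
have q z : V (Some z) -> [/\ scoord1 s z = g z, scoord2 s z = 0 & scoord3 s z = 0].
  by move=> Vz; apply: section_coords_uniq (VU Vz) _; rewrite e// !scale0r !addr0.
split; last by move=> z /q[].
apply/extension_coords; split.
- by apply: (sheaf_with_stalk_eq g1) hg => z /q[].
- by apply: (sheaf_with_stalk_eq g2) (sheaf_with_stalk_zero g2) => z /q[].
- by apply: (sheaf_with_stalk_eq g3) (sheaf_with_stalk_zero g3) => z /q[].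
Qed.

Lemma extension_ker3 s :
  (extension M V s /\ forall z, V (Some z) -> scoord1 s z = 0) <->
  exists g h, [/\ sh O2 V g, sh O3 V h & eq_on V s (fun z => g z *: frame2 z + h z *: frame3 z)].
Proof.
split=> [[/extension_coords[_ h2 h3] h1]|[g [h [hg hh e]]]].
  exists (scoord2 s), (scoord3 s); split=> // z Vz.
  by rewrite {1}(section_coords s (VU Vz)) h1// scale0r add0r.
have q z : V (Some z) -> [/\ scoord1 s z = 0, scoord2 s z = g z & scoord3 s z = h z].
  by move=> Vz; apply: section_coords_uniq (VU Vz) _; rewrite e// scale0r add0r.
split; last by move=> z /q[].
apply/extension_coords; split.
- by apply: (sheaf_with_stalk_eq g1) (sheaf_with_stalk_zero g1) => z /q[].
- by apply: (sheaf_with_stalk_eq g2) hg => z /q[].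
- by apply: (sheaf_with_stalk_eq g3) hh => z /q[].
Qed.

Lemma extension_add s a b : eq_on V s (fun z => a z + b z) ->
  extension M V a -> extension M V b -> extension M V s.
Proof.
move=> e /extension_coords[a1 a2 a3] /extension_coords[b1 b2 b3].
have q z : V (Some z) -> [/\ scoord1 s z = scoord1 a z + scoord1 b z,
    scoord2 s z = scoord2 a z + scoord2 b z
    & scoord3 s z = scoord3 a z + scoord3 b z].
  move=> Vz; have Uz := VU Vz; apply: section_coords_uniq (Uz) _; rewrite e//.
  rewrite {1}(section_coords a Uz) {1}(section_coords b Uz) !scalerDl.
  by rewrite addrACA [X in _ + X = _]addrACA.
apply/extension_coords; split.
- by apply: (sheaf_with_stalk_eq g1) (sheaf_with_stalk_add g1 a1 b1) => z /q[].
- by apply: (sheaf_with_stalk_eq g2) (sheaf_with_stalk_add g2 a2 b2) => z /q[].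
- by apply: (sheaf_with_stalk_eq g3) (sheaf_with_stalk_add g3 a3 b3) => z /q[].
Qed.

Lemma extension_split s : extension M V s <-> exists a b,
  [/\ extension M V a /\ (forall z, V (Some z) -> scoord2 a z = 0 /\ scoord3 a z = 0),
      extension M V b /\ (forall z, V (Some z) -> scoord1 b z = 0) &
      eq_on V s (fun z => a z + b z)].
Proof.
split=> [/extension_coords[h1 h2 h3]|[a [b [[ha _] [hb _] e]]]]; last first.
  exact: extension_add e ha hb.
exists (fun z => scoord1 s z *: frame1 z),
    (fun z => scoord2 s z *: frame2 z + scoord3 s z *: frame3 z); split.
- by apply/extension_ker1; exists (scoord1 s).
- by apply/extension_ker3; exists (scoord2 s), (scoord3 s).
- by move=> z Vz; exact: section_coords (VU Vz).
Qed.

End Extension.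

Lemma mero_group : germ_group (@mero R).
Proof. split; [exact: mero_cst|exact: mero_add|exact: mero_germ]. Qed.

Lemma germO_group n : germ_group (@germO R n).
Proof.
by split; [exact: germO_zero (germ_refl _)|exact: germO_add|exact: germO_germ].
Qed.

End Sheaf.

(** * The decomposition *)

Theorem theorem3p29 (R : realType) (f : {poly cplx R}) (hf : f != 0)
    (P : R -> set (germs R 3))
    (hgood : good_filtered_higgs (Etilde_oo f) P (theta_oo f))
    (hsym : symmetric_pairing (Etilde_oo f) P (theta_oo f) (@gramC R))
    (hperf : perfect_pairing (Etilde_oo f) P (@gramC R)) :
  let d2 := deg P (v2 f) in
  let d3 := deg P (v3 f) in
  exists U : set (P1 R), P1_open U /\ U None /\
    dsum_sheaf U (Etilde f) (E1 f) (E3 f) /\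
    forall c : R,
      [/\ dsum_sheaf U (PEtilde P c) (PE1 f P c) (PE3 f P c),
          eq_sheaf U (PE1 f P c)
            (line (Num.floor (c - ((size f).-1)%:R - 2)) (change_chart (s1 f))) &
          dsum_sheaf U (PE3 f P c)
            (line (Num.floor (c - d2)) (change_chart (v2 f)))
            (line (Num.floor (c - d3)) (change_chart (v3 f)))].
Proof.
move=> d2 d3; exists (good_nbhd f); split; first exact: open_good_nbhd; split=> //.
have fb : filtered_bundle (Etilde_oo f) P := hgood.1.1.
have mg := mero_group R; have gO := germO_group R.
have EE := Etilde_coords hf; have PEc := lattice_coordsP hf hgood hsym hperf.
have K1 V s : V `<=` good_nbhd f -> (forall z, V (Some z) ->
    (theta f.[z] - (pow2 (2 / 3) * f.[z])%:M) *m s z = 0) <->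
    (forall z, V (Some z) -> scoord2 f s z = 0 /\ scoord3 f s z = 0).
  by move=> VU; split=> h z Vz; have [ka kb] := ker1E s (VU _ Vz);
      [exact: (ka (h z Vz))|exact: (kb (h z Vz))].
have K3 V s : V `<=` good_nbhd f -> (forall z, V (Some z) ->
    (let N := theta f.[z] - (- pow2 (- (1 / 3)) * f.[z])%:M in N *m N) *m s z = 0) <->
    (forall z, V (Some z) -> scoord1 f s z = 0).
  by move=> VU; split=> h z Vz; have [ka kb] := ker3E s (VU _ Vz);
      [exact: (ka (h z Vz))|exact: (kb (h z Vz))].
have subE c V s : PEtilde P c V s -> Etilde f V s.
  by move=> [as_ Ps]; split=> // /Ps/(lattice_sub fb).
have PE1E c V s : V `<=` good_nbhd f -> PE1 f P c V s <->
    (extension (P c) V s /\ forall z, V (Some z) -> scoord2 f s z = 0 /\ scoord3 f s z = 0).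
  move=> VU; have K := K1 V s VU.
  split=> [[hP [_ /K hk]]|[hP /K hk]]; first by split.
  by split; [exact: hP|split; [exact: (subE c)|exact: hk]].
have PE3E c V s : V `<=` good_nbhd f -> PE3 f P c V s <->
    (extension (P c) V s /\ forall z, V (Some z) -> scoord1 f s z = 0).
  move=> VU; have K := K3 V s VU.
  split=> [[hP [_ /K hk]]|[hP /K hk]]; first by split.
  by split; [exact: hP|split; [exact: (subE c)|exact: hk]].
have disj V s : V `<=` good_nbhd f ->
    (forall z, V (Some z) -> scoord2 f s z = 0 /\ scoord3 f s z = 0) ->
    (forall z, V (Some z) -> scoord1 f s z = 0) -> eq_on V s (fun=> 0).
  move=> VU h h1 z Vz; have [h2 h3] := h z Vz.
  by rewrite (section_coords s (VU _ Vz)) h1// h2 h3 !scale0r !addr0.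
split.
  move=> V oV VU; split.
    move=> s; have X := extension_split oV VU mg mg mg EE s.
    split=> [/X[a [b [[ha ka] [hb kb] e]]]|[a [b [[ha ka] [hb kb] e]]]].
      exists a, b; split=> //; split=> //; first exact/(K1 _ _ VU).
      exact/(K3 _ _ VU).
    by apply/X; exists a, b; split=> //; split=> //; [exact/(K1 _ _ VU)|exact/(K3 _ _ VU)].
  by move=> s [_ ka] [_ kb]; apply: (disj V s VU); [exact/(K1 _ _ VU)|exact/(K3 _ _ VU)].
move=> c; split.
- move=> V oV VU; split.
    move=> s; have X := extension_split oV VU (gO _) (gO _) (gO _) (PEc c) s.
    split=> [/X[a [b [ha hb e]]]|[a [b [/(PE1E _ _ _ VU) ha /(PE3E _ _ _ VU) hb e]]]].
      by exists a, b; split=> //; [exact/(PE1E _ _ _ VU)|exact/(PE3E _ _ _ VU)].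
    by apply/X; exists a, b.
  by move=> s /(PE1E _ _ _ VU)[_ ?] /(PE3E _ _ _ VU)[_ ?]; exact: (disj V).
- move=> V oV VU; apply/seteqP; split=> s.
    by move=> /(PE1E _ _ _ VU)/(extension_ker1 oV VU (gO _) (gO _) (gO _) (PEc c)).
  by move=> h; apply/(PE1E _ _ _ VU)/(extension_ker1 oV VU (gO _) (gO _) (gO _) (PEc c)).
- move=> V oV VU; have X s := extension_ker3 oV VU (gO _) (gO _) (gO _) (PEc c) s; split.
    move=> s; split=> [/(PE3E _ _ _ VU)/X[g [h [hg hh e]]]|[a [b [[g [hg ea]] [h [hh eb]] e]]]].
      exists (fun z => g z *: frame2 f z), (fun z => h z *: frame3 f z); split=> //.
      - by exists g.
      - by exists h.
    apply/(PE3E _ _ _ VU)/X; exists g, h; split=> // z Vz.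
    by rewrite e// ea// eb.
  move=> s [g [_ eg]] [h [_ eh]] z Vz; have Uz := VU _ Vz.
  have [_ A _] : [/\ scoord1 f s z = 0, scoord2 f s z = g z & scoord3 f s z = 0].
    by apply: section_coords_uniq Uz _; rewrite eg// !scale0r add0r addr0.
  have [_ B _] : [/\ scoord1 f s z = 0, scoord2 f s z = 0 & scoord3 f s z = h z].
    by apply: section_coords_uniq Uz _; rewrite eh// !scale0r !add0r.
  by rewrite eg// -A B scale0r.
Qed.
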